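(* Let $d\ge 2$, $X\equiv\Delta^{d-1}=\{p\in\mathbb{R}^d_+:p_1+\cdots+p_d=1\}$, let $\mathcal{P}$ be the set of all nonconstant expected utility preferences on $X$, let $\lambda$ be the uniform distribution on $\Delta^{d-1}$, and let $q$ be an error probability function for which there exist $C>0$ and $k>0$ such that, for all $\succeq\,\in\mathcal{P}$ and all $p,p'\in\Delta^{d-1}$ with $p\succ p'$, $$q(\succeq;p,p')\ \ge\ \frac12+C\,|u\cdot p-u\cdot p'|^k,$$ where $u$ is the normalized vector of utility indices of $\succeq$. Then the Kemeny-minimizing estimator is consistent and, as $\eta\to0$ and $\delta\to0$, $$N(\eta,\delta)=O\!\left(\frac{1}{\eta^{8(d-1)+4k}}\ln\frac1\delta\right).$$
   Context: An expected utility preference is a relation $\succeq$ on $\Delta^{d-1}$ for which there is $v\in\mathbb{R}^d$ with $p\succeq p'$ iff $v\cdot p\ge v\cdot p'$; it is nonconstant if $p\succ p'$ for some $p,p'$. ($x\succ y$ means $x\succeq y$ and not $y\succeq x$; $x\sim y$ means both $x\succeq y$ and $y\succeq x$.) Each nonconstant expected utility preference is represented by a unique normalized vector of utility indices in $\{v\in\mathbb{R}^d:\sum_i v_i=0,\ \|v\|=1\}$ (Euclidean norm). The metric $\rho(\succeq,\succeq')$ on $\mathcal{P}$ is the Euclidean distance between the normalized vectors of $\succeq$ and $\succeq'$. An error probability function is $q:\mathcal{P}\times X\times X\to[0,1]$ such that $q(\succeq;\cdot,\cdot)$ is measurable for each $\succeq\,\in\mathcal{P}$ and $x\succ y$ implies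 $q(\succeq;x,y)>1/2$. A subject with preference $\succeq$ facing the unordered pair $\{x,y\}$ chooses $x$ with probability $q(\succeq;x,y)$ and $y$ with the complementary probability (so $q(\succeq;y,x)=1-q(\succeq;x,y)$ for $x\ne y$). The experiment $\Sigma_n=\{B_1,\dots,B_n\}$ consists of problems $B_j=\{x_j,y_j\}$ where all $x_j,y_j$ are drawn i.i.d. from $\lambda$; the choices of a subject with preference $\succeq^*\in\mathcal{P}$ are drawn, independently across problems, according to $q(\succeq^*;\cdot,\cdot)$. $R_n$ is the set of $(x,y)$ with $\{x,y\}\in\Sigma_n$ and $x$ chosen from $\{x,y\}$. The Kemeny-minimizing estimator $\succeq_n$ is any element of $\arg\min\{\frac1n|R_n\setminus\succeq|:\succeq\,\in\mathcal{P}\}$. Consistency means: for every subject preference $\succeq^*\in\mathcal{P}$ and every $\eta>0$, $\Pr(\rho(\succeq_n,\succeq^* )<\eta)\to1$ as $n\to\infty$. For $\eta>0$, $\delta\in(0,1)$, $N(\eta,\delta)$ is the smallest $N$ such that for all $n\ge N$ and all $\succeq^*\in\mathcal{P}$, $\Pr(\rho(\succeq_n,\succeq^* )<\eta)\ge1-\delta$ ($\infty$ if there is none). *)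

(* Defs.v *)
From HB Require Import structures.
From mathcomp Require Import all_boot all_order all_algebra finmap.
From mathcomp Require Import all_classical all_reals all_analysis.

Set Implicit Arguments.
Unset Strict Implicit.
Unset Printing Implicit Defensive.

Import Order.TTheory GRing.Theory Num.Theory.
Import numFieldNormedType.Exports.

Local Open Scope classical_set_scope.
Local Open Scope ring_scope.

Section Lebesgue.
Context {R : realType}.

Definition cons_pair (m : nat) (z : R * m.-tuple R) : m.+1.-tuple R :=
  [the m.+1.-tuple R of z.1 :: z.2].

Lemma measurable_cons_pair m : measurable_fun setT (@cons_pair m).
Proof. exact: measurable_cons. Qed.

HB.instance Definition _ m :=
  isMeasurableFun.Build _ _ _ _ (@cons_pair m) (@measurable_cons_pair m).

Section step.
Context (m : nat) (mu : {sigma_finite_measure set (m.-tuple R) -> \bar R}).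

Definition lebesgue_cons : set (m.+1.-tuple R) -> \bar R :=
  pushforward (@lebesgue_measure R \x mu)%E (@cons_pair m).

Let lebesgue_cons0 : lebesgue_cons set0 = 0%E.
Proof. by rewrite /lebesgue_cons /pushforward preimage_set0 measure0. Qed.

Let lebesgue_cons_ge0 A : (0 <= lebesgue_cons A)%E.
Proof. by rewrite /lebesgue_cons /pushforward measure_ge0. Qed.

Let lebesgue_cons_sigma_additive : semi_sigma_additive lebesgue_cons.
Proof.
move=> F mF tF mUF; rewrite /lebesgue_cons /pushforward preimage_bigcup.
have mP A : measurable A -> measurable (@cons_pair m @^-1` A).
  by move=> mA; rewrite -[X in measurable X]setTI; exact: measurable_cons_pair.
apply: measure_semi_sigma_additive.
- by move=> n; exact: mP.
- apply/trivIsetP => /= i j _ _ ij; rewrite -preimage_setI.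
  by move/trivIsetP : tF => /(_ _ _ _ _ ij) ->//; rewrite preimage_set0.
- by rewrite -preimage_bigcup; exact: mP.
Qed.

HB.instance Definition _ := isMeasure.Build _ _ _ lebesgue_cons
  lebesgue_cons0 lebesgue_cons_ge0 lebesgue_cons_sigma_additive.

Let lebesgue_cons_sigma_finite : sigma_finite setT lebesgue_cons.
Proof.
have /sigma_finiteP[F [FT ndF Foo]] := sigma_finiteT (@lebesgue_measure R).
have /sigma_finiteP[G [GT ndG Goo]] := sigma_finiteT mu.
pose g (t : m.+1.-tuple R) : R * m.-tuple R := (thead t, [tuple of behead t]).
have gK : cancel (@cons_pair m) g.
  by move=> [a t]; rewrite /g /cons_pair /= theadE; congr pair; exact: val_inj.
have mg : measurable_fun setT g.
  apply/measurable_fun_pairP; split; first exact: measurable_tnth.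
  exact: measurable_behead.
exists (fun n => g @^-1` (F n `*` G n)).
  apply/seteqP; split => // t _.
  have : setT (g t).1 by [].
  rewrite FT => -[i _ Fi].
  have : setT (g t).2 by [].
  rewrite GT => -[j _ Gj].
  exists (maxn i j) => //; split.
  - by move: (g t).1 Fi; exact/subsetPset/ndF/leq_maxl.
  - by move: (g t).2 Gj; exact/subsetPset/ndG/leq_maxr.
move=> n; have [mF Foon] := Foo n; have [mG Goon] := Goo n; split.
  by rewrite -[X in measurable X]setTI; apply: mg => //; exact: measurableX.
rewrite /lebesgue_cons /pushforward -comp_preimage.
rewrite (_ : g \o @cons_pair m = id); last exact/funext/gK.
by rewrite product_measure1E// lte_mul_pinfty// ge0_fin_numE.
Qed.

HB.instance Definition _ := Measure_isSigmaFinite.Build _ _ _ lebesgue_cons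
  lebesgue_cons_sigma_finite.

End step.

(* Lebesgue measure on R^m, as the m-fold product of the one on R. *)
Fixpoint lebesgue_tuple (m : nat) :
    {sigma_finite_measure set (m.-tuple R) -> \bar R} :=
  match m with
  | 0 => \d_[tuple]
  | m'.+1 => lebesgue_cons (lebesgue_tuple m')
  end.

End Lebesgue.

Section Simplex.
Context {R : realType} {m : nat}.

Definition in_simplex (p : 'rV[R]_m.+1) : bool :=
  [forall i, 0 <= p 0 i] && (\sum_i p 0 i == 1).

End Simplex.

(* The standard simplex of dimension m, in R^(m.+1). *)
Record simplex (R : realType) (m : nat) :=
  Simplex { weights :> 'rV[R]_m.+1; _ : in_simplex weights }.

Section SimplexStructures.
Context {R : realType} {m : nat}.
Local Notation X := (simplex R m).

HB.instance Definition _ := [isSub for @weights R m].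
HB.instance Definition _ := [Choice of X by <:].

Lemma vertex_in_simplex : in_simplex (delta_mx 0 0 : 'rV[R]_m.+1).
Proof.
apply/andP; split.
  by apply/forallP => i; rewrite mxE ler0n.
rewrite (bigD1 ord0)//= mxE !eqxx/= big1 ?addr0// => i i0.
by rewrite mxE (negbTE i0) andbF.
Qed.

HB.instance Definition _ := isPointed.Build X (Simplex vertex_in_simplex).

(* The sigma-algebra generated by the coordinates, i.e. the Borel one. *)
Let coors : 'I_m.+1 -> X -> R := fun i p => val p 0 i.

Let simplex_set0 : g_sigma_preimage coors set0.
Proof. exact: sigma_algebra0. Qed.

Let simplex_setC A : g_sigma_preimage coors A -> g_sigma_preimage coors (~` A).
Proof. exact: sigma_algebraC. Qed.

Let simplex_bigcup (F : _^nat) : (forall i, g_sigma_preimage coors (F i)) ->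
  g_sigma_preimage coors (\bigcup_i (F i)).
Proof. exact: sigma_algebra_bigcup. Qed.

HB.instance Definition _ := @isMeasurable.Build default_measure_display
  X (g_sigma_preimage coors) simplex_set0 simplex_setC simplex_bigcup.

Lemma measurable_weight i : measurable_fun setT (fun p : X => val p 0 i).
Proof.
move=> _ Y mY; rewrite setTI; apply: sub_sigma_algebra => /=.
rewrite -bigcup_seq/=; exists i => /=; first by rewrite mem_index_enum.
by exists Y => //; rewrite setTI.
Qed.

Lemma measurable_fun_simplex d (T : measurableType d) (f : T -> X) :
  (forall i, measurable_fun setT (fun t => val (f t) 0 i)) ->
  measurable_fun setT f.
Proof.
move=> mf; have : g_sigma_preimage (fun i => coors i \o f) `<=` measurable.
  apply: smallest_sub; first exact: sigma_algebra_measurable.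
  rewrite -bigcup_mkord_ord; apply: bigcup_sub => i Ii.
  by move=> A [B mB <-]; exact: mf.
by rewrite g_sigma_preimage_comp => fS _ A mA; apply: fS; exists A.
Qed.

End SimplexStructures.

Section Uniform.
Context {R : realType} {m : nat}.
Local Notation X := (simplex R m).

(* The projection of the simplex on the last m coordinates. *)
Definition solid_simplex : set (m.-tuple R) :=
  [set t | (forall i, 0 <= tnth t i) /\ \sum_i tnth t i <= 1].

Definition barycentric (t : m.-tuple R) : 'rV[R]_m.+1 :=
  \row_i if unlift ord0 i is Some j then tnth t j
         else 1 - \sum_j tnth t j.

(* Inverse of that projection; constant outside of [solid_simplex]. *)
Definition chart (t : m.-tuple R) : X := insubd (point : X) (barycentric t).

Lemma barycentric_simplexP t :
  reflect (solid_simplex t) (in_simplex (barycentric t)).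
Proof.
have E0 : barycentric t 0 ord0 = 1 - \sum_j tnth t j.
  by rewrite mxE unlift_none.
have ES (j : 'I_m) : barycentric t 0 (lift ord0 j) = tnth t j by rewrite mxE liftK.
have E1 : \sum_i barycentric t 0 i == 1.
  rewrite big_ord_recl E0 [X in _ + X](eq_bigr (tnth t)); first by rewrite subrK.
  by move=> j _; exact: ES.
rewrite /in_simplex E1 andbT; apply: (iffP forallP) => [h|[h1 h2] i].
  split=> [j|]; first by rewrite -ES.
  by rewrite -subr_ge0 -E0.
have [j ->|->] := unliftP ord0 i; first by rewrite ES.
by rewrite E0 subr_ge0.
Qed.

Lemma measurable_sum_tuple :
  measurable_fun setT (fun t : m.-tuple R => \sum_i tnth t i).
Proof. by apply: measurable_sum => i; exact: measurable_tnth. Qed.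

Lemma measurable_solid_simplex : measurable solid_simplex.
Proof.
rewrite (_ : solid_simplex =
  (\bigcap_(i in [set: 'I_m]) ((@tnth _ R)^~ i @^-1` [set x | 0 <= x])) `&`
  ((fun t => \sum_i tnth t i) @^-1` [set x | x <= 1])); last first.
  apply/seteqP; split => t /= [t0 t1]; split => //; first by move=> i _; exact: t0.
  by move=> i; exact: (t0 i I).
apply: measurableI.
  apply: fin_bigcap_measurable => // i _.
  rewrite -[X in measurable X]setTI; apply: measurable_tnth => //.
  by rewrite -set_itvcy; exact: measurable_itv.
rewrite -[X in measurable X]setTI; apply: measurable_sum_tuple => //.
by rewrite -set_itvNyc; exact: measurable_itv.
Qed.

Lemma measurable_chart : measurable_fun setT chart.
Proof.
apply: measurable_fun_simplex => i.
rewrite (_ : (fun t => _) = fun t => if t \in solid_simplex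
    then barycentric t 0 i else val (point : X) 0 i); last first.
  apply/funext => t; rewrite /chart val_insubd.
  case: barycentric_simplexP => ht; first by rewrite (mem_set ht).
  by rewrite (memNset ht).
apply: measurable_fun_ifT => //.
  apply: (measurable_fun_bool true); rewrite setTI.
  rewrite (_ : _ @^-1` _ = solid_simplex); first exact: measurable_solid_simplex.
  by apply/seteqP; split => t /= ?; [exact: set_mem|exact: mem_set].
under eq_fun do rewrite mxE.
case: unliftP => [j _|_]; first exact: measurable_tnth.
by apply: measurable_realfun.measurable_funB => //; exact: measurable_sum_tuple.
Qed.

HB.instance Definition _ := isMeasurableFun.Build _ _ _ _ chart measurable_chart.

(* Normalized Lebesgue measure of the solid simplex, transported by [chart].
   The default value of [mnormalize] plays no role, see [uniform_simplexE]. *)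
Definition uniform_simplex : probability X R :=
  distribution
    (mnormalize (mrestr (@lebesgue_tuple R m) measurable_solid_simplex)
                \d_(point : m.-tuple R)) chart.

End Uniform.

Section UniformFacts.
Context {R : realType}.
Local Open Scope ereal_scope.

Lemma lebesgue_tuple_box (m : nat) (a : R) : (0 <= a)%R ->
  measurable [set t : m.-tuple R | forall i, 0 <= tnth t i <= a]%R /\
  lebesgue_tuple m [set t : m.-tuple R | forall i, 0 <= tnth t i <= a]%R =
    (a ^+ m)%:E.
Proof.
move=> a0; elim: m => [|m [mB IH]].
  rewrite (_ : [set _ | _] = setT); last first.
    by apply/seteqP; split => // t _ [].
  by split => //=; rewrite diracT.
set B' := [set t : m.+1.-tuple R | _].
have B'E : @cons_pair R m @^-1` B' = `[0%R, a]%classic `*`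
    [set t : m.-tuple R | forall i, 0 <= tnth t i <= a]%R.
  apply/seteqP; split => -[x t] /=.
    move=> h; split; first by rewrite in_itv/=; exact: (h ord0).
    by move=> i; have := h (lift ord0 i); rewrite tnthS.
  rewrite in_itv/= => -[hx ht] i.
  by have [j ->|->] := unliftP ord0 i; [rewrite tnthS; exact: ht|].
split; last first.
  rewrite /= /lebesgue_cons /pushforward B'E product_measure1E//.
  have LI : lebesgue_measure `[0%R, a]%classic = a%:E.
    rewrite lebesgue_measure_itv/= lte_fin.
    have [_|ale0] := ltP 0%R a; first by rewrite sube0.
    by congr EFin; apply/le_anti/andP; split.
  by rewrite IH exprS EFinM; congr (_ * _); exact: LI.
rewrite (_ : B' = \bigcap_(i in [set: 'I_m.+1])
    ((@tnth _ R)^~ i @^-1` `[0%R, a]%classic)); last first.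
  apply/seteqP; split => t /= h i; first by move=> _; rewrite /= in_itv/=.
  by have := h i I; rewrite /= in_itv/=.
apply: fin_bigcap_measurable => // i _.
rewrite -[X in measurable X]setTI; apply: measurable_tnth => //.
Qed.

Lemma lebesgue_solid_simplex (m : nat) :
  0 < lebesgue_tuple m (@solid_simplex R m) < +oo.
Proof.
have [mB1 LB1] := @lebesgue_tuple_box m 1%R ler01.
have m0 : (0 < (m.+1%:R : R)^-1)%R by rewrite invr_gt0.
have [mBm LBm] := @lebesgue_tuple_box m (m.+1%:R^-1)%R (ltW m0).
have mS := @measurable_solid_simplex R m.
apply/andP; split.
  apply: (@lt_le_trans _ _ (lebesgue_tuple m
      [set t : m.-tuple R | forall i, 0 <= tnth t i <= m.+1%:R^-1]%R)).
    by rewrite LBm lte_fin exprn_gt0.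
  apply: le_measure; rewrite ?inE// => t /= ht.
  split; first by move=> i; have /andP[] := ht i.
  apply: (@le_trans _ _ (\sum_(i < m) m.+1%:R^-1)%R).
    by apply: ler_sum => i _; have /andP[] := ht i.
  rewrite sumr_const card_ord -[leLHS]mulr_natl.
  by rewrite ler_pdivrMr ?ltr0n// mul1r ler_nat.
apply: (@le_lt_trans _ _ (lebesgue_tuple m
    [set t : m.-tuple R | forall i, 0 <= tnth t i <= 1]%R)).
  apply: le_measure; rewrite ?inE// => t /= [t0 t1] i.
  rewrite t0/=; apply: le_trans t1.
  by rewrite (bigD1 i)//= lerDl sumr_ge0.
by rewrite LB1 ltry.
Qed.

Lemma uniform_simplexE (m : nat) (A : set (simplex R m)) :
  uniform_simplex A =
  lebesgue_tuple m (chart @^-1` A `&` solid_simplex) *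
  (fine (lebesgue_tuple m (@solid_simplex R m)))^-1%:E.
Proof.
have /andP[L0 Loo] := lebesgue_solid_simplex m.
pose mu : {measure set (m.-tuple R) -> \bar R} :=
  mrestr (@lebesgue_tuple R m) (@measurable_solid_simplex R m).
have muT : mu [set: m.-tuple R] = lebesgue_tuple m (@solid_simplex R m).
  by rewrite /mu/= /mrestr setTI.
transitivity (mnormalize mu \d_(point : m.-tuple R) (chart @^-1` A)) => //.
by rewrite /mnormalize muT gt_eqF//= lt_eqF.
Qed.

End UniformFacts.

Section Preferences.
Context {R : realType} {m : nat}.
Local Notation X := (simplex R m).
Local Notation V := 'rV[R]_m.+1.

(* A binary relation on lotteries; [w (p, p')] reads: p is weakly preferred
   to p'. *)
Definition preference := set (X * X).

Definition strictly (w : preference) (p p' : X) : Prop :=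
  w (p, p') /\ ~ w (p', p).

Definition dot (v : V) (p : X) : R := \sum_i v 0 i * val p 0 i.

Definition represents (v : V) (w : preference) : Prop :=
  forall p p', w (p, p') <-> dot v p >= dot v p'.

Definition nonconstant_eu : set preference :=
  [set w | (exists v, represents v w) /\ exists p p', strictly w p p'].

(* The library norm on matrices is the sup norm. *)
Definition euclid_norm (v : V) : R := Num.sqrt (\sum_i v 0 i ^+ 2).

Definition normalized (v : V) : Prop :=
  \sum_i v 0 i = 0 /\ euclid_norm v = 1.

(* Meaningful for [w] in [nonconstant_eu], where this vector exists and is
   unique. *)
Definition utility_index (w : preference) : V :=
  xget 0 [set v | normalized v /\ represents v w].

Definition pref_dist (w w' : preference) : R :=
  euclid_norm (utility_index w - utility_index w').

Record error_probability (q : preference -> X -> X -> R) : Prop := {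
  error_prob_01 : forall w, nonconstant_eu w ->
    forall p p', 0 <= q w p p' <= 1 ;
  error_prob_measurable : forall w, nonconstant_eu w ->
    measurable_fun [set: X * X] (fun z => q w z.1 z.2) ;
  error_prob_gt : forall w, nonconstant_eu w ->
    forall p p', strictly w p p' -> 2^-1 < q w p p' ;
  error_prob_compl : forall w, nonconstant_eu w ->
    forall p p', p <> p' -> q w p' p = 1 - q w p p' }.

End Preferences.
Arguments preference : clear implicits.
Arguments nonconstant_eu : clear implicits.

Section Experiment.
Context {R : realType} {m : nat} {d : measure_display} {T : measurableType d}.
Local Notation X := (simplex R m).
Variables (x y : nat -> {mfun T >-> X}) (c : nat -> {mfun T >-> bool}).

(* Problem j is {x j, y j}; [c j] is true when x j is chosen from it. *)
Definition observation (j : nat) (t : T) : X * X * bool := (x j t, y j t, c j t).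

(* The choices being independent across the i.i.d. problems and depending each
   on its own problem only means that the triples (x j, y j, c j) are mutually
   independent; the joint law of each of them is given by the first field. *)
Record experiment (q : X -> X -> R) (P : probability T R) : Prop := {
  experiment_law : forall (j : nat) (E : set (X * X)) (b : bool),
    measurable E ->
    P [set t | E (x j t, y j t) /\ c j t = b] =
    (\int[uniform_simplex \x uniform_simplex]_(z in E)
       (if b then q z.1 z.2 else 1 - q z.1 z.2)%:E)%E ;
  experiment_indep : forall (n : nat) (E : nat -> set (X * X * bool)),
    (forall j, measurable (E j)) ->
    P (\bigcap_(j in `I_n) observation j @^-1` E j) =
    (\prod_(j < n) P (observation j @^-1` E j))%E }.

Definition choice_pair (j : nat) (t : T) : X * X :=
  if c j t then (x j t, y j t) else (y j t, x j t).

Definition revealed (n : nat) (t : T) : set (X * X) :=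
  [set choice_pair j t | j in `I_n].

Definition kemeny_loss (n : nat) (t : T) (w : preference R m) : R :=
  n%:R^-1 * #|` fset_set (revealed n t `\` w)|%:R.

Definition kemeny_argmin (n : nat) (t : T) : set (preference R m) :=
  [set w | nonconstant_eu R m w /\
     forall w', nonconstant_eu R m w' -> kemeny_loss n t w <= kemeny_loss n t w'].

End Experiment.

Section InnerProbability.
Context {R : realType} {d : measure_display} {T : measurableType d}.
Local Open Scope ereal_scope.

(* A minimizer may be selected in a non-measurable way, so that probabilities
   of events that involve an estimator are read as inner probabilities; on
   measurable events nothing changes. *)
Definition inner_prob (P : probability T R) (E : set T) : \bar R :=
  ereal_sup [set P A | A in [set A | measurable A /\ A `<=` E]].

Lemma inner_probE (P : probability T R) (E : set T) :
  measurable E -> inner_prob P E = P E.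
Proof.
move=> mE; apply/eqP; rewrite eq_le; apply/andP; split.
  by apply: ge_ereal_sup => _ [A [mA AE] <-]; apply: le_measure; rewrite ?inE.
by apply: ereal_sup_ubound; exists E => //; split.
Qed.

End InnerProbability.

Section Asymptotics.
Context {R : realType} {m : nat} {d : measure_display} {T : measurableType d}.
Variables (P : preference R m -> probability T R).
Variables (est : nat -> T -> preference R m).

Definition success (n : nat) (w : preference R m) (eta : R) : set T :=
  [set t | pref_dist (est n t) w < eta].

Definition consistent : Prop :=
  forall w, nonconstant_eu R m w -> forall eta, 0 < eta ->
    (fun n => inner_prob (P w) (success n w eta)) @ \oo --> 1%E.

(* The infimum is attained when the set is nonempty, and is +oo otherwise. *)
Definition sample_complexity (eta delta : R) : \bar R :=
  ereal_inf [set (N%:R)%:E | N in [set N : nat |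
    forall n, (N <= n)%N -> forall w, nonconstant_eu R m w ->
      ((1 - delta)%:E <= inner_prob (P w) (success n w eta))%E]].

End Asymptotics.

(* Main.v *)
Require Import Defs.
From mathcomp Require Import all_boot all_order all_algebra finmap.
From mathcomp Require Import all_classical all_reals all_analysis.
From mathcomp Require Import measurable_realfun ring lra.
Import Order.TTheory GRing.Theory Num.Theory.
Import numFieldNormedType.Exports.
Local Open Scope classical_set_scope.
Local Open Scope ring_scope.

Set Implicit Arguments.
Unset Strict Implicit.
Unset Printing Implicit Defensive.

(** Let u be the subject's utility vector, and v another one at distance at
    least eta. There are two boxes of side of order eta such that u and v
    strictly disagree, with margin of order eta, on every pair with one
    lottery in each box. Hence in one problem v mispredicts the choice more
    often than u, by at least a constant times eta^(2(d-1)+k), even if a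
    prediction of v only counts as wrong when its margin exceeds some e > 0:
    this costs at most the probability that the margin of v is below e, which
    is O(e). A Chernoff bound makes it exponentially unlikely that u loses to
    this handicapped v on n problems. With e of order eta^(2(d-1)+k), a single
    handicapped v dominates all the utility vectors in a grid cell of mesh
    e/2, so that a union bound over polynomially many cells controls the
    Kemeny minimizer. Its loss counts distinct revealed pairs; almost surely no
    pair is revealed twice, so it also counts problems. *)

(** * Counting form of the Chernoff bound *)

Lemma measure_bigsetU_le {d} {T : measurableType d} {R : realType}
    (P : {measure set T -> \bar R}) (I : Type) (r : seq I) (p : pred I)
    (F : I -> set T) : (forall i, measurable (F i)) ->
  (P (\big[setU/set0]_(i <- r | p i) F i) <= \sum_(i <- r | p i) P (F i))%E.
Proof.
move=> mF; elim: r => [|i r IH]; first by rewrite !big_nil measure0.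
rewrite !big_cons; case: ifP => // _.
apply: (le_trans (measureU2 _ (mF i) _)); last exact: leeD2l.
exact: bigsetU_measurable.
Qed.

(** Since [expR (- x) >= 1 - x], the left side is at most 1 / (1 - x), and (1 - x)(1 + x + 2x^2) = 1
    + x^2 (1 - 2x) is at least 1 for x <= 1/2. *)
Lemma expR_le_quadratic {R : realType} (x : R) :
  x <= 2^-1 -> expR x <= 1 + x + 2 * x ^+ 2.
Proof.
move=> x2; have y0 : 0 < 1 - x by lra.
have -> : expR x = (expR (- x))^-1 by rewrite expRN invrK.
apply: (@le_trans _ _ (1 - x)^-1).
  by rewrite lef_pV2 ?posrE ?expR_gt0//; exact: expR_ge1Dx.
by rewrite -div1r ler_pdivrMr//; nra.
Qed.

Section Chernoff.
Context {R : realType} {d dS : measure_display} {T : measurableType d}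
  {S : measurableType dS}.
Variables (P : probability T R) (obs : nat -> T -> S) (A B : set S) (mu : R).
Hypothesis mobs : forall j, measurable_fun setT (obs j).
Hypothesis indep : forall n (E : nat -> set S), (forall j, measurable (E j)) ->
  P (\bigcap_(j in `I_n) obs j @^-1` E j) = (\prod_(j < n) P (obs j @^-1` E j))%E.
Hypotheses (mA : measurable A) (mB : measurable B) (mu01 : 0 <= mu <= 1).
Hypothesis gap : forall j, (P (obs j @^-1` B) + mu%:E <= P (obs j @^-1` A))%E.

(** Atoms of the algebra generated by [A] and [B]. The two counts depend on an observation only
    through its atom, which reduces the Chernoff bound to finite sums. *)
Let cell (ab : bool * bool) : set S :=
  (if ab.1 then A else ~` A) `&` (if ab.2 then B else ~` B).

Let mcell ab : measurable (cell ab).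
Proof. by rewrite /cell; case: ab => -[] [] /=; apply: measurableI => //; exact: measurableC. Qed.

Let mpre E j : measurable E -> measurable (obs j @^-1` E).
Proof. by move=> mE; rewrite -[X in measurable X]setTI; exact: mobs. Qed.

Let class (s : S) : bool * bool := (s \in A, s \in B).

Let cell_class s ab : cell ab s <-> class s = ab.
Proof.
rewrite /cell /class; case: ab => a b /=; split.
  move=> [hA hB]; congr pair.
    by case: a hA => hA; [exact: mem_set|exact: memNset].
  by case: b hB => hB; [exact: mem_set|exact: memNset].
case=> <- <-; split.
  by case: ifP => [/set_mem //|/negbT]; rewrite notin_setE.
by case: ifP => [/set_mem //|/negbT]; rewrite notin_setE.
Qed.

Let pr j ab := fine (P (obs j @^-1` cell ab)).

Let PE E j : measurable E -> P (obs j @^-1` E) = (fine (P (obs j @^-1` E)))%:E.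
Proof. by move=> mE; rewrite fineK// fin_num_measure//; exact: mpre. Qed.

Let tilt (ab : bool * bool) : R := expR (mu / 4 * (ab.2%:R - ab.1%:R)).

(** Write p10, p01 for the probabilities of [A] without [B] and of [B] without [A]. With t = mu / 4,
    [expR_le_quadratic] bounds the sum by 1 - t (p10 - p01) + 2 t^2 (p10 + p01) <= 1 - t mu + 2 t^2,
    and this t minimizes the last expression. *)
Let mgf_le j : \sum_ab pr j ab * tilt ab <= 1 - mu ^+ 2 / 8.
Proof.
have /andP[mu_ge0 mu_le1] := mu01.
have pr_ge0 ab : 0 <= pr j ab by rewrite fine_ge0.
have DI E F : measurable E -> measurable F -> P (obs j @^-1` E) =
    (P (obs j @^-1` (E `&` ~` F)) + P (obs j @^-1` (E `&` F)))%E.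
  by move=> mE mF; rewrite (measureDI P (mpre j mE) (mpre j mF)).
have EA : fine (P (obs j @^-1` A)) = pr j (true, true) + pr j (true, false).
  have := DI _ _ mA mB.
  rewrite (PE j mA) (PE j (mcell (true, true))) (PE j (mcell (true, false))).
  by rewrite -EFinD => -[->]; rewrite addrC.
have EB : fine (P (obs j @^-1` B)) = pr j (true, true) + pr j (false, true).
  have := DI _ _ mB mA.
  rewrite (setIC B (~` A)) (setIC B A).
  rewrite (PE j mB) (PE j (mcell (true, true))) (PE j (mcell (false, true))).
  by rewrite -EFinD => -[->]; rewrite addrC.
have EC : 1 = fine (P (obs j @^-1` A)) + pr j (false, true) + pr j (false, false).
  have := DI _ _ (measurableC mA) mB.
  rewrite preimage_setC probability_setC; last exact: mpre.
  rewrite (PE j mA) (PE j (mcell (false, true))) (PE j (mcell (false, false))).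
  rewrite -!EFinD => -[]; rewrite -/(pr _ _) -/(pr _ _) => e; lra.
have := gap j; rewrite (PE j mA) (PE j mB) -EFinD lee_fin => gapj.
rewrite (eq_bigr (fun ab => pr j (ab.1, ab.2) * tilt (ab.1, ab.2))); last by case.
rewrite -(pair_bigA _ (fun a b => pr j (a, b) * tilt (a, b)))/= !big_bool/=.
rewrite /tilt/= !subrr !mulr0 expR0 !mulr1 subr0 sub0r mulrN1.
have e1 : expR (- (mu / 4)) <= 1 - mu / 4 + 2 * (mu / 4) ^+ 2.
  by rewrite -(sqrrN (mu / 4)); apply: expR_le_quadratic; lra.
have e2 : expR (mu / 4) <= 1 + mu / 4 + 2 * (mu / 4) ^+ 2.
  by apply: expR_le_quadratic; lra.
have := ler_wpM2l (pr_ge0 (true, false)) e1.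
have := ler_wpM2l (pr_ge0 (false, true)) e2.
have := pr_ge0 (true, true); have := pr_ge0 (false, false).
rewrite mulr1.
move: (pr_ge0 (true, false)) (pr_ge0 (false, true)) EA EB EC gapj => /=.
set p10 := pr j (true, false); set p01 := pr j (false, true).
set p11 := pr j (true, true); set p00 := pr j (false, false) => h10 h01 -> -> EC gp h00 h11 l1 l2.
(* The two nonlinear facts that [lra] needs, from p10 - p01 >= mu and p10 + p01 <= 1. *)
have hm : 0 <= mu * (p10 - p01 - mu) by apply: mulr_ge0; lra.
have hq : 0 <= mu * (mu * (1 - p01 - p10)) by rewrite !mulr_ge0//; lra.
lra.
Qed.

(** Markov's inequality on a finite sum. [bad] is a finite union over sequences of atoms, whose
    probabilities factor by independence. On those sequences the product of the tilts is at least 1;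
    inserting it and summing over all sequences gives a product of n factors bounded by [mgf_le]. *)
Lemma chernoff_count n :
  let bad := [set t | (\sum_(j < n) (obs j t \in A) <= \sum_(j < n) (obs j t \in B))%N] in
  measurable bad /\ (P bad <= ((1 - mu ^+ 2 / 8) ^+ n)%:E)%E.
Proof.
have /andP[mu_ge0 mu_le1] := mu01.
pose ok (f : {ffun 'I_n -> bool * bool}) := (\sum_j (f j).1 <= \sum_j (f j).2)%N.
pose F (f : {ffun 'I_n -> bool * bool}) : set T :=
  \bigcap_(j in `I_n) obs j @^-1` cell (if insub j is Some i then f i else (true, true)).
have mF f : measurable (F f).
  by apply: fin_bigcap_measurable => // j _; exact: mpre.
have PF g : P (F g) = (\prod_(j < n) pr j (g j))%:E.
  rewrite /F (indep _ (E := fun j => cell (if insub j is Some i then g i else (true, true))))//.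
  rewrite -prodEFin; apply: eq_bigr => j _.
  by rewrite valK -PE.
move=> bad; have badE : bad = \big[setU/set0]_(f | ok f) F f.
  rewrite -bigcup_seq_cond; apply/seteqP; split => t.
    move=> bt; exists [ffun j : 'I_n => class (obs j t)].
      rewrite /= mem_index_enum /ok/=; apply: etrans bt; congr (_ <= _)%N.
        by apply: eq_bigr => j _; rewrite ffunE.
      by apply: eq_bigr => j _; rewrite ffunE.
    by move=> j jn; apply/cell_class; rewrite insubT ffunE.
  move=> [f /andP[_ okf] tf]; rewrite /bad/=; apply: etrans okf.
  have ft (j : 'I_n) : class (obs j t) = f j.
    by have /cell_class := tf j (ltn_ord j); rewrite valK.
  by congr (_ <= _)%N; apply: eq_bigr => j _; rewrite -ft.
split; first by rewrite badE; apply: bigsetU_measurable.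
rewrite badE; apply: le_trans (measure_bigsetU_le _ _ _ mF) _.
rewrite (eq_bigr _ (fun f _ => PF f)).
rewrite sumEFin lee_fin.
apply: (@le_trans _ _ (\sum_(f : {ffun 'I_n -> bool * bool})
    \prod_(j < n) (pr j (f j) * tilt (f j)))).
  rewrite big_mkcond/=; apply: ler_sum => f _.
  have pr0 : 0 <= \prod_(j < n) pr j (f j) by apply: prodr_ge0 => j _; rewrite fine_ge0.
  rewrite big_split/=; case: ifPn => okf; last first.
    by rewrite mulr_ge0// prodr_ge0// => j _; rewrite expR_ge0.
  rewrite ler_peMr// /tilt -expR_sum.
  apply: le_trans (expR_ge1Dx _); rewrite lerDl.
  rewrite -mulr_sumr sumrB -!natr_sum mulr_ge0 ?subr_ge0 ?ler_nat//; lra.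
rewrite -(bigA_distr_bigA (fun (j : 'I_n) ab => pr j ab * tilt ab)).
rewrite (_ : (1 - _) ^+ n = \prod_(j < n) (1 - mu ^+ 2 / 8)); last first.
  by rewrite prodr_const card_ord.
apply: ler_prod => j _; rewrite mgf_le andbT.
by apply: sumr_ge0 => ab _; rewrite mulr_ge0 ?fine_ge0 ?expR_ge0.
Qed.
End Chernoff.

(** * Sections of product measures *)

Section ProductSections.
Context {d1 d2 : measure_display} {T1 : measurableType d1}
  {T2 : measurableType d2} {R : realType}.
Variables (m1 : {sigma_finite_measure set T1 -> \bar R})
  (m2 : {sigma_finite_measure set T2 -> \bar R}).
Local Open Scope ereal_scope.

(** All nonempty sections sit over [C], of mass at most 1, so integrating their bound does not
    enlarge it even when [m1] is infinite, as Lebesgue measure is. *)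
Lemma product_measure_le_xsection (A : set (T1 * T2)) (C : set T1) (k : R) : (0 <= k)%R ->
  measurable A -> measurable C -> A `<=` C `*` setT ->
  m1 C <= 1 ->
  (forall x, m2 (xsection A x) <= k%:E) -> (m1 \x m2) A <= k%:E.
Proof.
move=> k0 mA mC AC C1 Ak; apply: (@le_trans _ _ (k%:E * m1 C)); last first.
  by rewrite -[leRHS]mule1 lee_wpmul2l// lee_fin.
rewrite /product_measure1 -integral_cst//.
rewrite (_ : m2 \o _ = (m2 \o xsection A) \_ C); last first.
  apply/funext => x; rewrite patchE; case: ifPn => //; rewrite notin_setE => Cx /=.
  rewrite (_ : xsection A x = set0) ?measure0//.
  by apply/seteqP; split => // y; rewrite /xsection/= inE => /AC[].
rewrite -integral_mkcond; apply: ge0_le_integral => //=.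
by apply: measurable_funTS; exact: measurable_fun_xsection.
Qed.

(** The product measure integrates x-sections by definition; Tonelli's theorem exchanges the
    order. *)
Lemma product_measure_le_ysection (A : set (T1 * T2)) (C : set T2) (k : R) : (0 <= k)%R ->
  measurable A -> measurable C -> A `<=` setT `*` C ->
  m2 C <= 1 ->
  (forall y, m1 (ysection A y) <= k%:E) -> (m1 \x m2) A <= k%:E.
Proof.
move=> k0 mA mC AC C1 Ak; apply: (@le_trans _ _ (k%:E * m2 C)); last first.
  by rewrite -[leRHS]mule1 lee_wpmul2l// lee_fin.
rewrite -integral_cst// -[A]setIT -integral_indic// fubini_tonelli2//=; last first.
  by apply/measurable_EFinP; exact: measurable_indic.
rewrite -/(EFin \o _) indic_fubini_tonelli_GE//.
rewrite (_ : m1 \o _ = (m1 \o ysection A) \_ C); last first.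
  apply/funext => y; rewrite patchE; case: ifPn => //; rewrite notin_setE => Cy /=.
  rewrite (_ : ysection A y = set0) ?measure0//.
  by apply/seteqP; split => // x; rewrite /ysection/= inE => /AC[].
rewrite -integral_mkcond; apply: ge0_le_integral => //=.
by apply: measurable_funTS; exact: measurable_fun_ysection.
Qed.

End ProductSections.

(** * Balls and slabs for Lebesgue measure *)

Section LebesgueTuple.
Context {R : realType}.

Lemma lebesgue_tupleS (m : nat) (A : set (m.+1.-tuple R)) :
  lebesgue_tuple m.+1 A =
  (@lebesgue_measure R \x lebesgue_tuple m)%E (@cons_pair R m @^-1` A).
Proof. by []. Qed.

Lemma measurable_cons_preimage (m : nat) (A : set (m.+1.-tuple R)) :
  measurable A -> measurable (@cons_pair R m @^-1` A).
Proof.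
by move=> mA; rewrite -[X in measurable X]setTI; exact: measurable_cons_pair.
Qed.

Lemma measurable_tuple_ball (m : nat) (a : 'I_m -> R) (r : R) :
  measurable [set t : m.-tuple R | forall i, `|tnth t i - a i| <= r].
Proof.
rewrite (_ : [set _ | _] = \bigcap_(i in [set: 'I_m])
    ((@tnth _ R)^~ i @^-1` `[a i - r, a i + r]%classic)); last first.
  apply/seteqP; split => t /= h i; first by move=> _; rewrite /= in_itv/= -ler_distl.
  by have := h i I; rewrite /= in_itv/= -ler_distl.
apply: fin_bigcap_measurable => // i _.
by rewrite -[X in measurable X]setTI; apply: measurable_tnth.
Qed.

Lemma lebesgue_interval (a r : R) : 0 <= r ->
  lebesgue_measure `[a - r, a + r]%classic = (2 * r)%:E.
Proof.
move=> r0; rewrite lebesgue_measure_itv/= lte_fin.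
have [_|h] := ltP (a - r) (a + r); first by rewrite -EFinB; congr EFin; lra.
by congr EFin; lra.
Qed.

Lemma lebesgue_tuple_ball (m : nat) (a : 'I_m -> R) (r : R) : 0 <= r ->
  lebesgue_tuple m [set t | forall i, `|tnth t i - a i| <= r] =
  ((2 * r) ^+ m)%:E.
Proof.
move=> r0; elim: m a => [|m IH] a.
  rewrite (_ : [set _ | _] = setT); last by apply/seteqP; split => // t _ [].
  by rewrite /= diracT.
rewrite lebesgue_tupleS (_ : _ @^-1` _ =
    `[a ord0 - r, a ord0 + r]%classic `*`
    [set t : m.-tuple R | forall i, `|tnth t i - a (lift ord0 i)| <= r]).
  rewrite product_measure1E//; last exact: measurable_tuple_ball.
  by rewrite IH exprS EFinM; congr (_ * _)%E; exact: lebesgue_interval.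
apply/seteqP; split => -[x t] /=.
  move=> h; split; first by rewrite in_itv/= -ler_distl; exact: (h ord0).
  by move=> i; have := h (lift ord0 i); rewrite tnthS.
rewrite in_itv/= -ler_distl => -[hx ht] i.
by have [j ->|->] := unliftP ord0 i; [rewrite tnthS; exact: ht|].
Qed.

Definition slab (m : nat) (al : 'I_m -> R) (be e : R) : set (m.-tuple R) :=
  [set t | (forall i, 0 <= tnth t i <= 1) /\
           `|\sum_i al i * tnth t i - be| <= e].

Lemma unit_cube (m : nat) :
  [set t : m.-tuple R | forall i, 0 <= tnth t i <= 1] =
  [set t | forall i, `|tnth t i - 2^-1| <= 2^-1].
Proof.
by apply/seteqP; split => t /= h i; have := h i; rewrite ler_distl => /andP[]; lra.
Qed.

Lemma measurable_slab (m : nat) (al : 'I_m -> R) (be e : R) :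
  measurable (slab al be e).
Proof.
rewrite /slab -[X in measurable X]/([set t : m.-tuple R | forall i, 0 <= tnth t i <= 1] `&`
  [set t | `|\sum_i al i * tnth t i - be| <= e]).
apply: measurableI.
  by rewrite unit_cube; exact: measurable_tuple_ball.
rewrite (_ : [set _ | _] =
    (fun t : m.-tuple R => \sum_i al i * tnth t i) @^-1` `[be - e, be + e]%classic).
  rewrite -[X in measurable X]setTI.
  have mf : measurable_fun setT (fun t : m.-tuple R => \sum_i al i * tnth t i).
    by apply: measurable_sum => i; apply: measurable_funM => //; exact: measurable_tnth.
  exact: mf.
by apply/seteqP; split => t /=; rewrite in_itv/= -ler_distl.
Qed.

(** One coefficient bounded below suffices: with the other coordinates fixed in the unit cube,
    coordinate [j] is confined to an interval of length 2e / c. The induction peels off the first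
    coordinate x: if it is not [j], its contribution is absorbed into the centre [be]; if it is, the
    sections in x are those intervals. *)
Lemma lebesgue_slab (m : nat) (al : 'I_m -> R) (j : 'I_m) (be e c : R) :
  0 <= e -> 0 < c <= `|al j| ->
  (lebesgue_tuple m (slab al be e) <= (2 * e / c)%:E)%E.
Proof.
move=> e0 /andP[c0]; have k0 : 0 <= 2 * e / c by apply: divr_ge0; lra.
elim: m al j be => [|m IH] al j be caj; first by case: j caj.
have mS := measurable_cons_preimage (measurable_slab al be e).
rewrite lebesgue_tupleS.
have sumE (x : R) (t : m.-tuple R) :
    \sum_i al i * tnth (cons_pair (x, t)) i =
    al ord0 * x + \sum_i al (lift ord0 i) * tnth t i.
  rewrite big_ord_recl tnth0; congr (_ + _); apply: eq_bigr => i _.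
  by rewrite tnthS.
have [i ji|j0] := unliftP ord0 j.
  rewrite ji in caj.
  have := @product_measure_le_xsection _ _ _ _ R lebesgue_measure
    (lebesgue_tuple m) _ `[0, 1]%classic _ k0 mS (measurable_itv _); apply.
  - by move=> [x t] [h _]; split => //=; rewrite in_itv/=; exact: (h ord0).
  - have := lebesgue_measure_itv `[0%R : R, 1%R]%R.
    by rewrite /= lte_fin ltr01 sube0 => /eqP; rewrite eq_le => /andP[].
  move=> x; apply: le_trans (IH (fun l => al (lift ord0 l)) i (be - al ord0 * x) caj).
  apply: le_measure; rewrite ?inE.
  - exact: measurable_xsection.
  - exact: measurable_slab.
  move=> t; rewrite /xsection/= inE => -[h1 h2]; split.
    by move=> l; have := h1 (lift ord0 l); rewrite tnthS.
  by move: h2; rewrite sumE opprB addrA (addrC (al ord0 * x)).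
have := @product_measure_le_ysection _ _ _ _ R lebesgue_measure
  (lebesgue_tuple m) _ [set t | forall i, `|tnth t i - 2^-1| <= 2^-1] _ k0 mS
  (measurable_tuple_ball _ _); apply.
- move=> [x t] [h _]; split => //.
  suff : [set u : m.-tuple R | forall i, 0 <= tnth u i <= 1] t by rewrite unit_cube.
  move=> i /=.
  by have := h (lift ord0 i); rewrite tnthS.
- by rewrite lebesgue_tuple_ball// divff// expr1n.
move=> t; pose s := \sum_i al (lift ord0 i) * tnth t i.
have a0 : 0 < `|al ord0| by rewrite -j0; exact: lt_le_trans caj.
have a0' : al ord0 != 0 by rewrite -normr_gt0.
apply: (@le_trans _ _ (lebesgue_measure
  `[(be - s) / al ord0 - e / c, (be - s) / al ord0 + e / c]%classic)).
  apply: le_measure; rewrite ?inE//; first exact: measurable_ysection.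
  move=> x; rewrite /ysection/= inE => -[_]; rewrite sumE -/s => h.
  rewrite in_itv/= -ler_distl.
  rewrite (_ : x - _ = (al ord0 * x + s - be) / al ord0); last by field.
  rewrite normrM normfV; apply: ler_pM => //.
  by rewrite lef_pV2 ?posrE// -j0.
have := lebesgue_interval ((be - s) / al ord0) (divr_ge0 e0 (ltW c0)).
by rewrite mulrA => /eqP; rewrite eq_le => /andP[].
Qed.

End LebesgueTuple.

(** * The uniform distribution on the simplex *)

Section SimplexMeasure.
Context {R : realType} {m : nat}.
Local Notation X := (simplex R m).

Definition simplex_volume : R := fine (lebesgue_tuple m (@solid_simplex R m)).

Lemma simplex_volume_gt0 : 0 < simplex_volume.
Proof. exact: fine_gt0 (lebesgue_solid_simplex m). Qed.

Lemma weight_ge0 (p : X) i : 0 <= val p 0 i.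
Proof. by case: p => p /= /andP[/forallP]. Qed.

Lemma sum_weight (p : X) : \sum_i val p 0 i = 1.
Proof. by case: p => p /= /andP[_ /eqP]. Qed.

Lemma measurable_dot (v : 'rV[R]_m.+1) : measurable_fun setT (dot v : X -> R).
Proof.
apply: measurable_sum => i; apply: measurable_funM => //.
exact: measurable_weight.
Qed.

Lemma val_chart (t : m.-tuple R) : solid_simplex t -> val (chart t) = barycentric t.
Proof. by move=> /barycentric_simplexP ht; rewrite /chart val_insubd ht. Qed.

Lemma chart_weight (t : m.-tuple R) (i : 'I_m) : solid_simplex t ->
  val (chart t) 0 (lift ord0 i) = tnth t i.
Proof. by move=> ht; rewrite val_chart// mxE liftK. Qed.

(** Eliminating the weight of index 0 makes utility affine in the chart, with slopes v_i - v_0; this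
    is why slab bounds are stated in terms of these differences. *)
Lemma dot_chart (v : 'rV[R]_m.+1) (t : m.-tuple R) : solid_simplex t ->
  dot v (chart t) = v 0 ord0 +
    \sum_(i < m) (v 0 (lift ord0 i) - v 0 ord0) * tnth t i.
Proof.
move=> ht; rewrite /dot big_ord_recl val_chart// mxE unlift_none mulrBr mulr1.
rewrite -addrA; congr (_ + _).
rewrite mulr_sumr addrC -sumrB; apply: eq_bigr => i _.
by rewrite mxE liftK mulrBl.
Qed.

Lemma solid_simplex_le1 (t : m.-tuple R) i : solid_simplex t -> 0 <= tnth t i <= 1.
Proof.
move=> [t0 t1]; rewrite t0/=; apply: le_trans t1.
by rewrite (bigD1 i)//= lerDl sumr_ge0.
Qed.

Lemma measurable_dot_slab (v : 'rV[R]_m.+1) (b e : R) :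
  measurable [set p : X | `|dot v p - b| <= e].
Proof.
rewrite (_ : [set _ | _] = dot v @^-1` `[b - e, b + e]%classic).
  by rewrite -[X in measurable X]setTI; exact: measurable_dot.
by apply/seteqP; split => t /=; rewrite in_itv/= -ler_distl.
Qed.

Lemma measurable_chart_preimage (A : set X) : measurable A ->
  measurable (chart @^-1` A `&` @solid_simplex R m).
Proof.
move=> mA; apply: measurableI; last exact: measurable_solid_simplex.
by rewrite -[X in measurable X]setTI; exact: measurable_chart.
Qed.

Lemma uniform_dot_slab (v : 'rV[R]_m.+1) (j : 'I_m) (b e c : R) : 0 <= e ->
  0 < c <= `|v 0 (lift ord0 j) - v 0 ord0| ->
  (uniform_simplex [set p : X | `|dot v p - b| <= e]%R <=
   (2 * e / c / simplex_volume)%:E)%E.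
Proof.
move=> e0 cj; rewrite uniform_simplexE EFinM.
apply: lee_wpmul2r; first by rewrite lee_fin invr_ge0 ltW// simplex_volume_gt0.
have := lebesgue_slab (al := fun i => v 0 (lift ord0 i) - v 0 ord0)
  (b - v 0 ord0) e0 cj.
apply: le_trans; apply: le_measure; rewrite ?inE.
- by apply: measurable_chart_preimage; exact: measurable_dot_slab.
- exact: measurable_slab.
move=> t [/= h st]; split; first by move=> i; exact: solid_simplex_le1.
by move: h; rewrite dot_chart// opprB addrA (addrC (v 0 ord0)).
Qed.

(** Only the chart coordinates are constrained, so that in the chart this is a genuine cube. *)
Definition simplex_box (a : 'rV[R]_m.+1) (r : R) : set X :=
  [set p : X | forall i : 'I_m, `|val p 0 (lift ord0 i) - a 0 (lift ord0 i)| <= r].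

Lemma measurable_simplex_box (a : 'rV[R]_m.+1) (r : R) :
  measurable (simplex_box a r).
Proof.
rewrite (_ : simplex_box a r = \bigcap_(i in [set: 'I_m])
    ((fun p : X => val p 0 (lift ord0 i)) @^-1`
      `[a 0 (lift ord0 i) - r, a 0 (lift ord0 i) + r]%classic)); last first.
  apply/seteqP; split => t /= h i; first by move=> _; rewrite /= in_itv/= -ler_distl.
  by have := h i I; rewrite /= in_itv/= -ler_distl.
apply: fin_bigcap_measurable => // i _.
by rewrite -[X in measurable X]setTI; apply: measurable_weight.
Qed.

(** The lower bounds on [a] keep the whole cube inside the solid simplex, so none of its volume is
    cut off. *)
Lemma uniform_simplex_box (a : 'rV[R]_m.+1) (r : R) : 0 <= r ->
  \sum_i a 0 i = 1 -> m%:R * r <= a 0 ord0 ->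
  (forall i : 'I_m, r <= a 0 (lift ord0 i)) ->
  uniform_simplex (simplex_box a r) = ((2 * r) ^+ m / simplex_volume)%:E.
Proof.
move=> r0 a1 ra0 ra; rewrite uniform_simplexE EFinM; congr (_ * _)%E.
rewrite -(lebesgue_tuple_ball (fun i : 'I_m => a 0 (lift ord0 i)) r0).
congr (lebesgue_tuple m _); apply/seteqP; split => t /=.
  by move=> [h st] i; have := h i; rewrite chart_weight.
move=> h; have st : solid_simplex t.
  split=> [i|]; first by have := h i; rewrite ler_distl => /andP[]; have := ra i; lra.
  apply: (@le_trans _ _ (\sum_(i < m) (a 0 (lift ord0 i) + r))).
    by apply: ler_sum => i _; have := h i; rewrite ler_distl => /andP[].
  rewrite big_split/= sumr_const card_ord -[r *+ m]mulr_natl.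
  by move: a1; rewrite big_ord_recl; lra.
by split => // i; rewrite chart_weight.
Qed.

End SimplexMeasure.

(** * Normalized utility vectors *)

Section UtilityVectors.
Context {R : realType} {m : nat}.
Local Notation X := (simplex R m).
Local Notation V := 'rV[R]_m.+1.
Implicit Types (u v : V) (p : X) (w : preference R m).

Lemma euclid_norm_sqr v : euclid_norm v ^+ 2 = \sum_i v 0 i ^+ 2.
Proof. by rewrite sqr_sqrtr// sumr_ge0// => i _; rewrite sqr_ge0. Qed.

Lemma euclid_norm_ge0 v : 0 <= euclid_norm v.
Proof. exact: sqrtr_ge0. Qed.

Lemma ler_euclid_norm v i : `|v 0 i| <= euclid_norm v.
Proof.
rewrite -(ler_pXn2r (ltn0Sn 1)) ?nnegrE ?euclid_norm_ge0//.
rewrite real_normK ?num_real// euclid_norm_sqr (bigD1 i)//= lerDl.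
by rewrite sumr_ge0// => j _; rewrite sqr_ge0.
Qed.

Lemma normalized_sqr v : normalized v -> \sum_i v 0 i ^+ 2 = 1.
Proof. by move=> [_ v1]; rewrite -euclid_norm_sqr v1 expr1n. Qed.

Lemma normalized_le1 v i : normalized v -> `|v 0 i| <= 1.
Proof. by move=> [_ <-]; exact: ler_euclid_norm. Qed.

(** Weights sum to 1, so subtracting the mean shifts all utilities equally; dividing by the norm
    then keeps the order. The centred vector is nonzero because some preference is strict. *)
Lemma utility_indexP w : nonconstant_eu R m w ->
  normalized (utility_index w) /\ represents (utility_index w) w.
Proof.
move=> [[v vw] [p [p' [wpp' wp'p]]]].
suff : exists v', [set v | normalized v /\ represents v w] v' by exact: xgetPex.
pose mean := (\sum_i v 0 i) / m.+1%:R.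
pose v1 : V := v - const_mx mean.
have dv1 q : dot v1 q = dot v q - mean.
  rewrite /dot -[mean in RHS]mulr1 -(sum_weight q) mulr_sumr -sumrB.
  by apply: eq_bigr => i _; rewrite !mxE mulrBl.
have v1n : 0 < euclid_norm v1.
  rewrite lt_neqAle euclid_norm_ge0 andbT eq_sym; apply/eqP => n0.
  have d0 q : dot v1 q = 0.
    rewrite /dot big1// => i _; have := ler_euclid_norm v1 i.
    by rewrite n0 normr_le0 => /eqP ->; rewrite mul0r.
  by apply: wp'p; apply/vw; move: (d0 p) (d0 p'); rewrite !dv1; lra.
exists ((euclid_norm v1)^-1 *: v1); split; first split.
- rewrite (eq_bigr (fun i => (euclid_norm v1)^-1 * v1 0 i)); last first.
    by move=> i _; rewrite mxE.
  rewrite -mulr_sumr (_ : \sum_i _ = 0) ?mulr0//.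
  rewrite (eq_bigr (fun i => v 0 i - mean)); last by move=> i _; rewrite !mxE.
  by rewrite sumrB sumr_const card_ord -[mean *+ _]mulr_natl /mean mulrC divfK ?subrr.
- rewrite /euclid_norm (eq_bigr (fun i => (euclid_norm v1)^-1 ^+ 2 * v1 0 i ^+ 2)).
    rewrite -mulr_sumr -euclid_norm_sqr -exprMn mulVf ?gt_eqF//.
    by rewrite expr1n sqrtr1.
  by move=> i _; rewrite mxE exprMn.
move=> q q'.
have dZ z : dot ((euclid_norm v1)^-1 *: v1) z = (euclid_norm v1)^-1 * dot v1 z.
  by rewrite /dot mulr_sumr; apply: eq_bigr => i _; rewrite mxE mulrA.
by rewrite !dZ ler_pM2l ?invr_gt0// !dv1 lerD2r; exact: vw.
Qed.

(** As the entries sum to 0, 1 = sum of v_i^2 = sum of v_i (v_i - v_0). Since |v_i| <= 1, this would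
    be less than 1 if all differences were below 1 / (m + 1). *)
Lemma normalized_gap v : normalized v ->
  exists j : 'I_m, m.+1%:R^-1 <= `|v 0 (lift ord0 j) - v 0 ord0|.
Proof.
move=> nv; apply/not_existsP => h.
have [v0 _] := nv.
have hi i : `|v 0 i - v 0 ord0| < m.+1%:R^-1.
  have [j ->|->] := unliftP ord0 i; first by rewrite ltNge; apply/negP/h.
  by rewrite subrr normr0 invr_gt0 ltr0n.
have : \sum_i v 0 i ^+ 2 = \sum_i v 0 i * (v 0 i - v 0 ord0).
  under [RHS]eq_bigr do rewrite mulrBr -expr2.
  by rewrite sumrB -mulr_suml v0 mul0r subr0.
rewrite normalized_sqr// => e1.
have : \sum_i v 0 i * (v 0 i - v 0 ord0) < \sum_(i < m.+1) m.+1%:R^-1.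
  apply: ltr_sum; first by apply/hasP; exists ord0; rewrite // mem_index_enum.
  move=> i _; apply: le_lt_trans (hi i).
  apply: le_trans (ler_norm _) _; rewrite normrM ler_piMl//.
  exact: normalized_le1.
by rewrite -e1 sumr_const card_ord -[_ *+ m.+1]mulr_natl divff ?ltxx// pnatr_eq0.
Qed.

(** The differences of the weights of two lotteries have absolute sum at most 2. This is what
    converts a grid mesh of e/2 into a loss of margin e. *)
Lemma dot_sub_perturb u v p p' (e : R) : (forall i, `|u 0 i - v 0 i| <= e) ->
  `|(dot u p - dot u p') - (dot v p - dot v p')| <= 2 * e.
Proof.
move=> uv; rewrite /dot -!sumrB.
apply: (le_trans (ler_norm_sum _ _ _)).
apply: (@le_trans _ _ (\sum_i (e * val p 0 i + e * val p' 0 i))).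
  apply: ler_sum => i _.
  rewrite (_ : _ - _ = (u 0 i - v 0 i) * (val p 0 i - val p' 0 i)); last by ring.
  rewrite normrM -mulrDr ler_pM//.
  apply: (le_trans (ler_normB _ _)).
  by rewrite !ger0_norm ?weight_ge0.
by rewrite big_split/= -!mulr_sumr !sum_weight; lra.
Qed.

(** The weight of index 0 compensates the others and may deviate by m r; bounding every deviation by
    (m + 1) r and summing over m + 1 coordinates gives the square. *)
Lemma simplex_box_dot u (a : V) (r : R) p : 0 <= r -> normalized u ->
  \sum_i a 0 i = 1 -> simplex_box a r p ->
  `|dot u p - \sum_i u 0 i * a 0 i| <= m.+1%:R ^+ 2 * r.
Proof.
move=> r0 nu a1 pa; rewrite /dot -sumrB.
have dev i : `|val p 0 i - a 0 i| <= m.+1%:R * r.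
  have [j ->|->] := unliftP ord0 i.
    apply: le_trans (pa j) _; rewrite ler_peMl// ler1n.
    exact: ltn0Sn.
  have := sum_weight p; move: a1; rewrite !big_ord_recl => a1 p1.
  have -> : val p 0 ord0 - a 0 ord0 =
      - \sum_(i < m) (val p 0 (lift ord0 i) - a 0 (lift ord0 i)).
    by rewrite sumrB; lra.
  rewrite normrN; apply: (le_trans (ler_norm_sum _ _ _)).
  apply: (@le_trans _ _ (\sum_(i < m) r)); first by apply: ler_sum => j _; exact: pa.
  rewrite sumr_const card_ord -[r *+ m]mulr_natl ler_wpM2r// ler_nat.
  exact: leqnSn.
apply: (le_trans (ler_norm_sum _ _ _)).
apply: (@le_trans _ _ (\sum_(i < m.+1) (m.+1%:R * r))).
  apply: ler_sum => i _; rewrite -mulrBr normrM -[leRHS]mul1r ler_pM//.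
  exact: normalized_le1.
by rewrite sumr_const card_ord -[_ *+ m.+1]mulr_natl expr2 mulrA.
Qed.

(* The boxes are centred at the barycentre plus or minus a multiple of the unit
   vector along u - v, on which u and v take opposite values. *)
Lemma opposed_boxes u v (eta : R) : normalized u -> normalized v ->
  0 < eta <= 1 -> eta <= euclid_norm (v - u) ->
  let r := eta / (16 * m.+1%:R ^+ 3) in
  exists a b : V, [/\
    uniform_simplex (simplex_box a r) = ((2 * r) ^+ m / @simplex_volume R m)%:E,
    uniform_simplex (simplex_box b r) = ((2 * r) ^+ m / @simplex_volume R m)%:E &
    forall p p', simplex_box a r p -> simplex_box b r p' ->
      eta / (4 * m.+1%:R) <= dot u p - dot u p' /\
      dot v p - dot v p' <= - (eta / (4 * m.+1%:R))].
Proof.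
move=> nu nv /andP[eta0 eta1] uv r.
pose D : R := m.+1%:R; have D1 : 1 <= D by rewrite ler1n.
have D0 : 0 < D by lra.
have Dn : D != 0 by rewrite gt_eqF.
set rho := euclid_norm (v - u) in uv.
have rho0 : 0 < rho by exact: lt_le_trans uv.
have rhon : rho != 0 by rewrite gt_eqF.
pose h i := (u 0 i - v 0 i) / rho.
have h1 i : `|h i| <= 1.
  rewrite normrM normfV (gtr0_norm rho0) ler_pdivrMr// mul1r distrC.
  by have := ler_euclid_norm (v - u) i; rewrite !mxE.
have sh : \sum_i h i = 0.
  by rewrite -mulr_suml sumrB; have [-> _] := nu; have [-> _] := nv; rewrite subrr mul0r.
(* For unit vectors |v - u|^2 = 2 - 2 u.v, whence u.h = rho / 2 = - v.h below. *)
have rho2 : rho ^+ 2 = 2 - 2 * \sum_i u 0 i * v 0 i.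
  rewrite euclid_norm_sqr.
  rewrite (eq_bigr (fun i => v 0 i ^+ 2 + u 0 i ^+ 2 - 2 * (u 0 i * v 0 i))); last first.
    by move=> i _; rewrite !mxE; ring.
  by rewrite sumrB big_split/= !normalized_sqr// -mulr_sumr; lra.
have uh : \sum_i u 0 i * h i = rho / 2.
  rewrite (eq_bigr (fun i => (u 0 i ^+ 2 - u 0 i * v 0 i) / rho)); last first.
    by move=> i _; rewrite /h; ring.
  rewrite -mulr_suml sumrB normalized_sqr//.
  rewrite (_ : 1 - _ = rho ^+ 2 / 2); first by field.
  by rewrite rho2; lra.
have vh : \sum_i v 0 i * h i = - (rho / 2).
  rewrite (eq_bigr (fun i => (u 0 i * v 0 i - v 0 i ^+ 2) / rho)); last first.
    by move=> i _; rewrite /h; ring.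
  rewrite -mulr_suml sumrB normalized_sqr//.
  rewrite (_ : _ - 1 = - (rho ^+ 2 / 2)); first by field.
  by rewrite rho2; lra.
have r0 : 0 < r by rewrite divr_gt0// mulr_gt0// exprn_gt0.
(* [E] is 1 / D made opaque: with these facts the remaining inequalities are linear. *)
have : exists E : R, [/\ E = D^-1, 0 < E, D * r <= E / 2,
    D ^+ 2 * r = E * eta / 16 & eta / (4 * D) = E * eta / 4].
  exists D^-1; split=> //; first by rewrite invr_gt0.
  - rewrite (_ : D * r = D^-1 * (eta / (16 * D))); last by rewrite /r -/D; field.
    rewrite ler_pM2l ?invr_gt0// ler_pdivrMr; lra.
  - by rewrite /r -/D; field.
  - by field.
move=> [E [EE E0 Dr e16 e4]].
(* The centres are [c 1] and [c (-1)]. The step E / 2 leaves every coordinate at least E / 2 >= D r,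
   room enough for the box. The centres differ in utility by E rho / 2, and the boxes cost at most E
   eta / 16 each, so at least E eta / 4 remains. *)
pose c (s : R) : V := \row_i (E + s * (E / 2 * h i)).
have cE s u' : \sum_i u' 0 i * c s 0 i =
    E * (\sum_i u' 0 i) + s * (E / 2) * (\sum_i u' 0 i * h i).
  rewrite !mulr_sumr -big_split/=; apply: eq_bigr => i _.
  by rewrite mxE; ring.
have c1 s : \sum_i c s 0 i = 1.
  rewrite (eq_bigr (fun i => E + s * (E / 2) * h i)); last first.
    by move=> i _; rewrite mxE mulrA.
  rewrite big_split/= -mulr_sumr sh mulr0 addr0 sumr_const card_ord.
  by rewrite -[_ *+ _]mulr_natl EE divff.
have c_ge s i : `|s| <= 1 -> D * r <= c s 0 i.
  move=> s1; rewrite mxE.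
  have : `|s * (E / 2 * h i)| <= E / 2.
    have D2 : 0 <= E / 2 by lra.
    by rewrite mulrCA normrM (ger0_norm D2) ler_piMr// normrM mulr_ile1.
  by rewrite ler_norml => /andP[? ?]; lra.
have box s : `|s| <= 1 -> uniform_simplex (simplex_box (c s) r) =
    ((2 * r) ^+ m / @simplex_volume R m)%:E.
  move=> s1; apply: uniform_simplex_box => //; first exact: ltW.
  - apply: le_trans (c_ge s ord0 s1); rewrite ler_pM2r// ler_nat.
    exact: leqnSn.
  - move=> i; apply: le_trans (c_ge s _ s1); rewrite ler_peMl//; lra.
exists (c 1), (c (-1)); split; [apply: box; rewrite normr1//|
  apply: box; rewrite normrN1//|].
move=> p p' pc pc'.
have eD : E * eta <= E * rho by rewrite ler_pM2l.
have [su _] := nu; have [sv _] := nv.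
have := simplex_box_dot (ltW r0) nu (c1 _) pc.
have := simplex_box_dot (ltW r0) nu (c1 _) pc'.
have := simplex_box_dot (ltW r0) nv (c1 _) pc.
have := simplex_box_dot (ltW r0) nv (c1 _) pc'.
rewrite !cE su sv uh vh -/D e16 e4 !ler_distl.
move=> /andP[? ?] /andP[? ?] /andP[? ?] /andP[? ?].
by split; lra.
Qed.

End UtilityVectors.

(** * The law of one choice *)

Section Choices.
Context {R : realType} {m : nat} {d : measure_display} {T : measurableType d}.
Local Notation X := (simplex R m).
Variables (x y : nat -> {mfun T >-> X}) (c : nat -> {mfun T >-> bool}).
Variables (q : X -> X -> R) (P : probability T R).
Hypothesis hexp : experiment x y c q P.
Hypothesis q01 : forall p p', 0 <= q p p' <= 1.
Hypothesis mq : measurable_fun [set: X * X] (fun z => q z.1 z.2).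

Local Notation pair_law :=
  (@uniform_simplex R m \x @uniform_simplex R m)%E.

Let chosen (o : X * X * bool) : X * X := if o.2 then o.1 else (o.1.2, o.1.1).

Let mswap : measurable_fun [set: X * X] (fun z => (z.2, z.1)).
Proof. by apply: measurable_fun_pair; [exact: measurable_snd|exact: measurable_fst]. Qed.

Let mchosen : measurable_fun setT chosen.
Proof.
apply: measurable_fun_ifT; [exact: measurable_snd|exact: measurable_fst|].
exact: (measurableT_comp mswap measurable_fst).
Qed.

Let mobs j : measurable_fun setT (observation x y c j).
Proof. by apply: measurable_fun_pair => //; exact: measurable_fun_pair. Qed.

Let choice_pairE j : choice_pair x y c j = chosen \o observation x y c j.
Proof. by []. Qed.

Lemma measurable_choice_pair j : measurable_fun setT (choice_pair x y c j).
Proof. by rewrite choice_pairE; exact: (measurableT_comp mchosen (mobs j)). Qed.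

Lemma choice_pair_indep n (E : nat -> set (X * X)) :
  (forall j, measurable (E j)) ->
  P (\bigcap_(j in `I_n) choice_pair x y c j @^-1` E j) =
  (\prod_(j < n) P (choice_pair x y c j @^-1` E j))%E.
Proof.
move=> mE; apply: (experiment_indep hexp n (E := fun j => chosen @^-1` E j)) => j.
by rewrite -[X in measurable X]setTI; exact: mchosen.
Qed.

(** Conditional probability, given the problem [z], that the pair ordered with the chosen lottery
    first lies in [A]. *)
Definition choice_density (A : set (X * X)) (z : X * X) : R :=
  \1_A z * q z.1 z.2 + \1_A (z.2, z.1) * (1 - q z.1 z.2).

Lemma choice_density_ge0 A z : 0 <= choice_density A z.
Proof.
have /andP[q0 q1] := q01 z.1 z.2.
by rewrite addr_ge0// mulr_ge0// subr_ge0.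
Qed.

Let mindic_swap (A : set (X * X)) : measurable A ->
  measurable_fun setT (fun z : X * X => \1_A (z.2, z.1) : R).
Proof. by move=> mA; exact: (measurableT_comp (measurable_indic mA) mswap). Qed.

Lemma measurable_choice_density A : measurable A ->
  measurable_fun setT (choice_density A).
Proof.
move=> mA; apply: measurable_funD; apply: measurable_funM => //.
- exact: mindic_swap.
- exact: measurable_funB.
Qed.

Lemma choice_pair_law j A : measurable A ->
  P (choice_pair x y c j @^-1` A) =
  (\int[pair_law]_z (choice_density A z)%:E)%E.
Proof.
move=> mA; pose A' := (fun z : X * X => (z.2, z.1)) @^-1` A.
have mA' : measurable A' by rewrite -[X in measurable X]setTI; exact: mswap.
have mxy : measurable_fun setT (fun t => (x j t, y j t)) by exact: measurable_fun_pair.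
have mE E b : measurable E -> measurable [set t | E (x j t, y j t) /\ c j t = b].
  move=> mE; rewrite -[X in measurable X]/(((fun t => (x j t, y j t)) @^-1` E) `&`
    (c j @^-1` [set b])).
  apply: measurableI; first by rewrite -[X in measurable X]setTI; exact: mxy.
  by rewrite -[X in measurable X]setTI; exact: measurable_funP.
rewrite (_ : _ @^-1` _ = [set t | A (x j t, y j t) /\ c j t = true] `|`
    [set t | A' (x j t, y j t) /\ c j t = false]); last first.
  apply/seteqP; split => t; rewrite /choice_pair /A' /=.
    by case: (c j t) => ?; [left|right].
  by case: (c j t) => -[[]|[]].
transitivity (P [set t | A (x j t, y j t) /\ c j t = true] +
    P [set t | A' (x j t, y j t) /\ c j t = false])%E.
  apply: measureU; [exact: mE|exact: mE|].
  by apply/seteqP; split => // t /= [[_ ->]] [].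
rewrite !(experiment_law hexp)// integral_mkcond [X in (_ + X)%E]integral_mkcond.
rewrite -ge0_integralD//=.
- apply: eq_integral => z _; rewrite !patchE /choice_density !indicE EFinD.
  rewrite (_ : ((z.2, z.1) \in A) = (z \in A')).
    by do 2 case: ifP => _; rewrite ?mul1r ?mul0r.
  by apply/idP/idP => /set_mem h; apply/mem_set.
- by move=> z _; rewrite patchE; case: ifP => // _; rewrite lee_fin; have /andP[] := q01 z.1 z.2.
- apply/(measurable_restrictT _ _).1 => //; apply: measurable_funTS.
  exact/measurable_EFinP.
- move=> z _; rewrite patchE; case: ifP => // _; rewrite lee_fin subr_ge0.
  by have /andP[] := q01 z.1 z.2.
- apply/(measurable_restrictT _ _).1 => //; apply: measurable_funTS.
  by apply/measurable_EFinP; exact: measurable_funB.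
Qed.

Lemma measurable_dot_sub (v : 'rV[R]_m.+1) :
  measurable_fun setT (fun z : X * X => dot v z.1 - dot v z.2).
Proof.
apply: measurable_funB.
- exact: (measurableT_comp (measurable_dot v) measurable_fst).
- exact: (measurableT_comp (measurable_dot v) measurable_snd).
Qed.

Lemma measurable_worse (v : 'rV[R]_m.+1) (e : R) :
  measurable [set z : X * X | dot v z.1 - dot v z.2 < e].
Proof.
rewrite (_ : [set _ | _] = (fun z : X * X => dot v z.1 - dot v z.2) @^-1` `]-oo, e[%classic).
  by rewrite -[X in measurable X]setTI; exact: measurable_dot_sub.
by apply/seteqP; split => t /=; rewrite in_itv.
Qed.

Lemma measurable_pair_slab (v : 'rV[R]_m.+1) (e : R) :
  measurable [set z : X * X | `|dot v z.1 - dot v z.2| <= e].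
Proof.
rewrite (_ : [set _ | _] = (fun z : X * X => dot v z.1 - dot v z.2) @^-1` `[-e, e]%classic).
  by rewrite -[X in measurable X]setTI; exact: measurable_dot_sub.
by apply/seteqP; split => t /=; rewrite in_itv/= ler_norml.
Qed.

(** For a fixed second lottery the section is a slab in the first one, and [uniform_dot_slab] does
    not depend on its centre. *)
Lemma uniform_pair_slab (v : 'rV[R]_m.+1) (e : R) : normalized v -> 0 <= e ->
  (pair_law [set z : X * X | `|dot v z.1 - dot v z.2| <= e]%R <=
   (2 * e * m.+1%:R / @simplex_volume R m)%:E)%E.
Proof.
move=> nv e0; have [j vj] := normalized_gap nv.
have V0 := @simplex_volume_gt0 R m.
apply: (product_measure_le_ysection (C := setT)) => //.
- by apply: divr_ge0; [rewrite !mulr_ge0|exact: ltW].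
- exact: measurable_pair_slab.
- exact: (probability_le1 (@uniform_simplex R m) measurableT).
move=> p'; rewrite -[m.+1%:R]invrK.
apply: le_trans (uniform_dot_slab (v := v) (j := j) (dot v p') e0 _); last first.
  by rewrite vj andbT invr_gt0.
apply: le_measure; rewrite ?inE.
- by apply: measurable_ysection; exact: measurable_pair_slab.
- exact: measurable_dot_slab.
- by move=> p; rewrite /ysection/= inE.
Qed.

(** The chosen lottery is one of the two offered, so its density is at most the sum of two slab
    indicators, whatever [q] is; hence twice the mass of one slab. *)
Lemma choice_dot_slab j (v : 'rV[R]_m.+1) (b e : R) : normalized v -> 0 <= e ->
  (P (choice_pair x y c j @^-1` [set z | `|dot v z.1 - b| <= e]%R) <=
   (4 * e * m.+1%:R / @simplex_volume R m)%:E)%E.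
Proof.
move=> nv e0; have [i vi] := normalized_gap nv.
pose S : set X := [set p | `|dot v p - b| <= e].
have mS : measurable S by exact: measurable_dot_slab.
have S_le : (uniform_simplex S <= (2 * e * m.+1%:R / @simplex_volume R m)%:E)%E.
  rewrite -[m.+1%:R]invrK; apply: (uniform_dot_slab (j := i)) => //.
  by rewrite vi andbT invr_gt0.
have mS1 : measurable (S `*` [set: X]) by exact: measurableX.
have mS2 : measurable ([set: X] `*` S) by exact: measurableX.
rewrite (_ : [set z | _] = S `*` setT); last by apply/seteqP; split => z //= [].
rewrite choice_pair_law//.
apply: (@le_trans _ _ (\int[pair_law]_z ((\1_(S `*` setT) z)%:E + (\1_(setT `*` S) z)%:E))%E).
  apply: ge0_le_integral => //=.
  - by move=> z _; rewrite lee_fin; exact: choice_density_ge0.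
  - by apply/measurable_EFinP; exact: measurable_choice_density.
  - by apply: emeasurable_funD; apply/measurable_EFinP; exact: measurable_indic.
  move=> z _; rewrite -EFinD lee_fin /choice_density !indicE.
  rewrite (_ : ((z.2, z.1) \in S `*` setT) = (z \in setT `*` S)); last first.
    by apply/idP/idP => /set_mem[? ?]; apply/mem_set.
  have /andP[q0 q1] := q01 z.1 z.2.
  by apply: lerD; rewrite ler_piMr//; lra.
rewrite ge0_integralD//=; last 2 first.
- by apply/measurable_EFinP; exact: measurable_indic.
- by apply/measurable_EFinP; exact: measurable_indic.
rewrite !integral_indic// !setIT.
have eS1 : pair_law (S `*` setT) = uniform_simplex S.
  rewrite product_measure1E// -[RHS]mule1; congr (_ * _)%E.
  exact: probability_setT.
have eS2 : pair_law (setT `*` S) = uniform_simplex S.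
  rewrite product_measure1E// -[RHS]mul1e; congr (_ * _)%E.
  exact: probability_setT.
have S_le1 : (pair_law (S `*` setT) <= (2 * e * m.+1%:R / @simplex_volume R m)%:E)%E.
  by rewrite eS1.
have S_le2 : (pair_law (setT `*` S) <= (2 * e * m.+1%:R / @simplex_volume R m)%:E)%E.
  by rewrite eS2.
apply: (le_trans (leeD S_le1 S_le2)).
by rewrite -EFinD lee_fin le_eqVlt; apply/orP; left; apply/eqP; ring.
Qed.

End Choices.

(** * Almost sure absence of ties *)

Lemma card_fset_set_seq {K : choiceType} (s : seq K) : uniq s ->
  #|` fset_set [set` s]| = size s.
Proof.
move=> us; rewrite (_ : fset_set _ = [fset k in s]%fset).
  by rewrite card_fseq undup_id.
by apply/fsetP => k; rewrite in_fset_set// !inE; apply/idP/idP; rewrite inE.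
Qed.

Section Ties.
Context {R : realType} {m : nat} {d : measure_display} {T : measurableType d}.
Local Notation X := (simplex R m).
Variables (x y : nat -> {mfun T >-> X}) (c : nat -> {mfun T >-> bool}).

Lemma card_revealed_setD (n : nat) (t : T) (w : preference R m) :
  (forall i j, (i < n)%N -> (j < n)%N ->
    choice_pair x y c i t = choice_pair x y c j t -> i = j) ->
  #|` fset_set (revealed x y c n t `\` w)| =
  (\sum_(j < n) (choice_pair x y c j t \in ~` w))%N.
Proof.
move=> inj.
pose s := [seq choice_pair x y c j t | j <- iota 0 n & choice_pair x y c j t \in ~` w].
have -> : revealed x y c n t `\` w = [set` s].
  apply/seteqP; split => z.
    move=> [[j jn <-] wz] /=; apply/mapP; exists j => //.
    by rewrite mem_filter mem_iota/= add0n jn andbT; exact: mem_set.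
  move=> /mapP[j]; rewrite mem_filter mem_iota/= add0n => /andP[/set_mem jw jn] ->.
  by split => //; exists j.
rewrite card_fset_set_seq; last first.
  rewrite map_inj_in_uniq ?filter_uniq ?iota_uniq// => i j.
  by rewrite !mem_filter !mem_iota/= !add0n => /andP[_ ?] /andP[_ ?]; exact: inj.
rewrite size_map size_filter -sum1_count big_mkcond/= -(big_mkord xpredT
  (fun j => nat_of_bool (choice_pair x y c j t \in ~` w))) /index_iota subn0.
by apply: eq_bigr => j _; case: ifP.
Qed.

Variables (q : X -> X -> R) (P : probability T R).
Hypothesis hexp : experiment x y c q P.
Hypothesis q01 : forall p p', 0 <= q p p' <= 1.
Hypothesis mq : measurable_fun [set: X * X] (fun z => q z.1 z.2).
Variable v : 'rV[R]_m.+1.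
Hypothesis nv : normalized v.

(** Repetitions are detected through one scalar, the utility of the chosen lottery: equal pairs have
    equal values, and slabs of this scalar have small probability. *)
Let f j t := dot v (choice_pair x y c j t).1.

Let mf j : measurable_fun setT (f j).
Proof.
apply: (measurableT_comp (measurable_dot v)).
exact: (measurableT_comp measurable_fst (measurable_choice_pair x y c j)).
Qed.

Lemma normr_dot_le1 (p : X) : `|dot v p| <= 1.
Proof.
apply: (le_trans (ler_norm_sum _ _ _)); rewrite -(sum_weight p).
apply: ler_sum => i _; rewrite normrM (ger0_norm (weight_ge0 p i)).
by rewrite ler_piMl ?weight_ge0//; exact: normalized_le1.
Qed.

Let tie i j := [set t | f i t = f j t].

Let mtie i j : measurable (tie i j).
Proof.
rewrite (_ : tie i j = (fun t => f i t - f j t) @^-1` [set 0]).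
  rewrite -[X in measurable X]setTI.
  have mfg : measurable_fun setT (fun t => f i t - f j t) by exact: measurable_funB.
  exact: mfg.
apply/seteqP; split => t; rewrite /tie/=; first by move=> ->; rewrite subrr.
by move/eqP; rewrite subr_eq0 => /eqP.
Qed.

(* The diagonal is covered by 2 M + 1 squares of side 2 / M, each hit with
   probability O(M ^- 2). *)
Let tie_le i j M : i != j -> (0 < M)%N ->
  (P (tie i j) <=
   (3 * (4 * m.+1%:R / @simplex_volume R m) ^+ 2 / M%:R)%:E)%E.
Proof.
move=> ij M0.
have M0' : 0 < M%:R :> R by rewrite ltr0n.
pose b (l : nat) : R := l%:R / M%:R - 1.
pose S l : set (X * X) := [set z | `|dot v z.1 - b l| <= M%:R^-1].
have mS l : measurable (S l).
  rewrite (_ : S l = [set p : X | `|dot v p - b l| <= M%:R^-1] `*` setT).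
    by apply: measurableX => //; exact: measurable_dot_slab.
  by apply/seteqP; split => z //= [].
have mpS k l : measurable (choice_pair x y c k @^-1` S l).
  by rewrite -[X in measurable X]setTI; exact: measurable_choice_pair.
pose F l := (choice_pair x y c i @^-1` S l) `&` (choice_pair x y c j @^-1` S l).
have mF l : measurable (F l) by exact: measurableI.
pose kap := 4 * M%:R^-1 * m.+1%:R / @simplex_volume R m.
have kap0 : 0 <= kap.
  by rewrite /kap divr_ge0// ?mulr_ge0// ltW// simplex_volume_gt0.
have PF l : (P (F l) <= (kap * kap)%:E)%E.
  have n0 : (i < (maxn i j).+1)%N by rewrite ltnS leq_maxl.
  have n1 : (j < (maxn i j).+1)%N by rewrite ltnS leq_maxr.
  (* Independence is stated for initial segments, so the indices other than i and j receive the full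
     space. *)
  have := @choice_pair_indep _ _ _ _ x y c q P hexp (maxn i j).+1
    (fun k => if (k == i) || (k == j) then S l else setT).
  rewrite (bigD1 (Ordinal n0))//= (bigD1 (Ordinal n1))/=; last by rewrite eq_sym.
  rewrite big1 ?mule1 => [|k /andP[ki kj]]; last first.
    rewrite -!val_eqE/= in ki kj.
    by rewrite (negbTE ki) (negbTE kj) preimage_setT probability_setT.
  rewrite !eqxx/= orbT (_ : \bigcap_(k in _) _ = F l) => [->|]; last first.
    apply/seteqP; split => t.
      by move=> h; split; [have := h i n0|have := h j n1]; rewrite /= eqxx// orbT.
    by move=> [ti tj] k kn /=; case: ifP => // /orP[] /eqP ->.
    by move=> k; case: ifP.
  by rewrite EFinM; apply: lee_pmul => //; apply: (choice_dot_slab hexp) => //;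
    rewrite invr_ge0.
have cover : tie i j `<=` \big[setU/set0]_(l < (2 * M).+1) F l.
  move=> t tt; rewrite -bigcup_mkord.
  (* The covering square is indexed by the integer part of [z], at most 2 M because utilities lie in
     [-1, 1]. *)
  pose z := (f i t + 1) * M%:R.
  have := normr_dot_le1 (choice_pair x y c i t).1; rewrite -/(f i t) ler_norml => /andP[f0 f1].
  have z0 : 0 <= z by rewrite mulr_ge0//; lra.
  have /andP[l0 l1] := truncn_itv z0.
  have S_l k : f k t = f i t -> S (Num.truncn z) (choice_pair x y c k t).
    move=> ki; rewrite /S/= -/(f k t) ki /b.
    rewrite (_ : _ - _ = (z - (Num.truncn z)%:R) * M%:R^-1); last first.
      by rewrite /z; field; rewrite gt_eqF.
    rewrite normrM (ger0_norm (_ : 0 <= M%:R^-1)) ?invr_ge0//.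
    rewrite ler_piMl ?invr_ge0// ger0_norm ?subr_ge0//.
    by move: l1; rewrite -natr1; lra.
  exists (Num.truncn z); last by split; exact: S_l.
  rewrite /= ltnS -(ler_nat R); apply: (le_trans l0).
  by rewrite natrM ler_wpM2r//; lra.
apply: (@le_trans _ _ (P (\big[setU/set0]_(l < (2 * M).+1) F l))).
  by apply: le_measure; rewrite ?inE//; exact: bigsetU_measurable.
apply: le_trans (measure_bigsetU_le _ _ _ (fun l : 'I_(2 * M).+1 => mF l)) _.
apply: (@le_trans _ _ (\sum_(l < (2 * M).+1) (kap * kap)%:E)%E).
  by apply: lee_sum => l _; exact: PF.
rewrite sumEFin lee_fin sumr_const card_ord -[_ *+ _]mulr_natl.
have -> : kap * kap = (4 * m.+1%:R / @simplex_volume R m) ^+ 2 / M%:R / M%:R.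
  by rewrite /kap; field; rewrite ?gt_eqF ?simplex_volume_gt0.
set K := _ ^+ 2; rewrite mulrA ler_pM2r ?invr_gt0//.
rewrite mulrA ler_pdivrMr// mulrAC ler_wpM2r ?sqr_ge0//.
rewrite -natr1 natrM; have : 1 <= M%:R :> R by rewrite ler1n.
lra.
Qed.

(** The bound of [tie_le] is K / M; if the probability were a > 0, taking M just above K / a would
    contradict it. *)
Let tie_null i j : i != j -> P (tie i j) = 0%E.
Proof.
move=> ij; apply/eqP; rewrite eq_le measure_ge0 andbT.
have Pfin : P (tie i j) \is a fin_num by exact: fin_num_measure.
set K := 3 * (4 * m.+1%:R / @simplex_volume R m) ^+ 2.
rewrite -(fineK Pfin) lee_fin leNgt; apply/negP; set a := fine _ => a0.
have K0 : 0 <= K / a by rewrite divr_ge0 ?(ltW a0)// /K mulr_ge0// sqr_ge0.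
have /andP[_ h] := truncn_itv K0.
have := tie_le ij (ltn0Sn (Num.truncn (K / a))).
rewrite -(fineK Pfin) -/a lee_fin -/K ler_pdivlMr ?ltr0n//.
by apply/negP; rewrite -ltNge; move: h; rewrite ltr_pdivrMr// mulrC.
Qed.

(** The exceptional set is given as a measurable null set so that it can be joined to the Chernoff
    events in [failure_bound]. *)
Lemma choice_pairs_distinct (n : nat) : exists N, [/\ measurable N, P N = 0%E &
  forall t, ~ N t -> forall i j, (i < n)%N -> (j < n)%N ->
    choice_pair x y c i t = choice_pair x y c j t -> i = j].
Proof.
pose N := \big[setU/set0]_(ij : 'I_n * 'I_n | ij.1 != ij.2) tie ij.1 ij.2.
exists N; split.
- exact: bigsetU_measurable.
- apply/eqP; rewrite eq_le measure_ge0 andbT.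
  apply: le_trans (measure_bigsetU_le _ _ _ _) _; first by move=> ij; exact: mtie.
  by rewrite big1// => ij hij; apply: tie_null.
- move=> t Nt i j iN jN e; apply/eqP/negP => /negP ij; apply: Nt.
  rewrite /N -bigcup_seq_cond; exists (Ordinal iN, Ordinal jN).
    by rewrite /= mem_index_enum.
  by rewrite /tie/= /f e.
Qed.

End Ties.

(** * Excess loss of a wrong preference *)

Section Excess.
Context {R : realType} {m : nat} {d : measure_display} {T : measurableType d}.
Local Notation X := (simplex R m).
Local Notation V := 'rV[R]_m.+1.
Variables (x y : nat -> {mfun T >-> X}) (c : nat -> {mfun T >-> bool}).
Variables (q : X -> X -> R) (P : probability T R) (u : V) (C k : R).
Hypothesis hexp : experiment x y c q P.
Hypothesis q01 : forall p p', 0 <= q p p' <= 1.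
Hypothesis mq : measurable_fun [set: X * X] (fun z => q z.1 z.2).
Hypothesis q_compl : forall p p', p <> p' -> q p' p = 1 - q p p'.
Hypothesis C_gt0 : 0 < C.
Hypothesis k_gt0 : 0 < k.
Hypothesis nu : normalized u.
Hypothesis q_ge : forall p p', dot u p' < dot u p ->
  2^-1 + C * `|dot u p - dot u p'| `^ k <= q p p'.

Local Notation pair_law :=
  (@uniform_simplex R m \x @uniform_simplex R m)%E.

(** The first lottery is the chosen one, so these are the choices that v mispredicts by a margin
    above [e], the handicap. *)
Definition worse (v : V) (e : R) : set (X * X) :=
  [set z | dot v z.1 - dot v z.2 < - e].

Let indic_pred (Q : pred (X * X)) (z : X * X) : \1_[set z' | Q z'] z = (Q z)%:R :> R.
Proof.
by rewrite indicE; congr (nat_of_bool _)%:R; apply/idP/idP => [/set_mem//|Qz]; exact: mem_set.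
Qed.

(** Off [D], u errs with probability at most both q and 1 - q, while v errs with one of these
    probabilities or the slab indicator pays 1. On [D], u errs with probability 1 - q and v with
    probability q, and q - (1 - q) >= 2 C s^k. *)
Let choice_density_gap (v : V) (s e : R) (D : set (X * X)) (z : X * X) :
  0 < s -> 0 <= e ->
  (forall z, D z -> s <= dot u z.1 - dot u z.2 /\ dot v z.1 - dot v z.2 < - e) ->
  choice_density q (worse u 0) z + 2 * C * s `^ k * \1_D z <=
  choice_density q (worse v e) z +
  \1_[set z : X * X | `|dot v z.1 - dot v z.2| <= e] z.
Proof.
case: z => p p' s0 e0 hD; rewrite /choice_density /worse !indic_pred/= oppr0.
have /andP[q0 q1] := q01 p p'.
have D01 : \1_D (p, p') = 0 :> R \/ [/\ \1_D (p, p') = 1 :> R, s <= dot u p - dot u p' &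
    dot v p - dot v p' < - e].
  have [Dz|h] := pselect (D (p, p')).
    by right; have [? ?] := hD _ Dz; split => //; rewrite indicE mem_set.
  by left; rewrite indicE memNset.
have -> : dot u p' - dot u p = - (dot u p - dot u p') by rewrite opprB.
have -> : dot v p' - dot v p = - (dot v p - dot v p') by rewrite opprB.
have qpp' : 0 < dot u p - dot u p' ->
    2^-1 + C * `|dot u p - dot u p'| `^ k <= q p p'.
  by move=> h; apply: q_ge; lra.
have qp'p : dot u p - dot u p' < 0 -> q p p' <= 2^-1.
  move=> h; have p'p : p' <> p by move=> pp'; move: h; rewrite pp' subrr ltxx.
  rewrite q_compl//; have uu : dot u p < dot u p' by lra.
  have := q_ge uu; have := powR_ge0 `|dot u p' - dot u p| k.
  by move=> /(mulr_ge0 (ltW C_gt0)); lra.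
move: (dot u p - dot u p') (dot v p - dot v p') D01 qpp' qp'p => a b D01 qpp' qp'p.
have slab_case : [|| b < - e, - b < - e | `|b| <= e].
  rewrite ler_norml; case: (ltP b (- e)) => //= h; case: (ltP (- b) (- e)) => //= h'.
  by lra.
have rhs_ge z : z <= q p p' -> z <= 1 - q p p' ->
    z <= (b < - e)%R%:R * q p p' + (- b < - e)%R%:R * (1 - q p p') + (`|b| <= e)%R%:R.
  move=> zq z1q; move: slab_case.
  case: (b < - e); case: (- b < - e); case: (`|b| <= e) => //= _;
    by rewrite ?mul1r ?mul0r ?addr0 ?add0r; lra.
case: D01 => [->|[-> sa be]].
  (* Six goals: the error of u compared with q, then with 1 - q, for each sign of its margin a. *)
  rewrite mulr0 addr0; apply: rhs_ge; have [a0|a0|<-] := ltgtP 0 a.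
  - have := mulr_ge0 (ltW C_gt0) (powR_ge0 `|a| k); have := qpp' a0.
    by rewrite oppr_lt0 a0 mul0r mul1r; lra.
  - by have := qp'p a0; rewrite oppr_lt0 ltNge (ltW a0)/= mul0r mul1r; lra.
  - by rewrite oppr0 ltxx !mul0r addr0.
  - have := mulr_ge0 (ltW C_gt0) (powR_ge0 `|a| k); have := qpp' a0.
    by rewrite oppr_lt0 a0 mul0r mul1r; lra.
  - by have := qp'p a0; rewrite oppr_lt0 ltNge (ltW a0)/= mul0r mul1r; lra.
  - by rewrite oppr0 ltxx !mul0r addr0 subr_ge0.
have a0 : 0 < a by exact: lt_le_trans sa.
have : s `^ k <= `|a| `^ k.
  by apply: ge0_ler_powR; rewrite ?nnegrE ?normr_ge0 ?gtr0_norm// ltW.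
move=> /(ler_wpM2l (ltW C_gt0)); have := qpp' a0.
rewrite oppr_lt0 a0 be ltNge (ltW a0)/= mul0r !mul1r !mulr1 add0r.
have : 0 <= (- b < - e)%R%:R * (1 - q p p') + (`|b| <= e)%R%:R.
  by rewrite addr_ge0// mulr_ge0// subr_ge0.
lra.
Qed.

(* The slab pays for the pairs on which the handicapped v abstains. *)
Lemma choice_pair_gap (v : V) (s e : R) (D : set (X * X)) j :
  0 < s -> 0 <= e -> measurable D ->
  (forall z, D z -> s <= dot u z.1 - dot u z.2 /\ dot v z.1 - dot v z.2 < - e) ->
  (P (choice_pair x y c j @^-1` worse u 0) + (2 * C * s `^ k)%:E * pair_law D <=
   P (choice_pair x y c j @^-1` worse v e) +
   pair_law [set z | `|dot v z.1 - dot v z.2| <= e]%R)%E.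
Proof.
move=> s0 e0 mD hD.
have mw v' e' : measurable (worse v' e') by exact: measurable_worse.
have kap0 : 0 <= 2 * C * s `^ k.
  by rewrite mulr_ge0 ?powR_ge0// mulr_ge0// ltW.
have mS := measurable_pair_slab v e.
rewrite !(choice_pair_law hexp)//.
have ID (A : set (X * X)) : measurable A ->
    pair_law A = (\int[pair_law]_z (\1_A z)%:E)%E.
  by move=> mA; rewrite integral_indic// setIT.
have mI (A : set (X * X)) : measurable A ->
    measurable_fun setT (fun z => (\1_A z : R)%:E).
  by move=> mA; apply/measurable_EFinP; exact: measurable_indic.
have mphi A : measurable A -> measurable_fun setT (fun z => (choice_density q A z)%:E).
  by move=> mA; apply/measurable_EFinP; exact: measurable_choice_density.
have phi0 A z : setT z -> (0 <= (choice_density q A z)%:E)%E.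
  by move=> _; rewrite lee_fin; exact: choice_density_ge0.
rewrite (ID D mD) (ID _ mS) -ge0_integralZl//; last exact: mI.
have mkI : measurable_fun setT (fun z => ((2 * C * s `^ k)%:E * (\1_D z : R)%:E)%E).
  by apply: emeasurable_funM => //; exact: mI.
rewrite -!ge0_integralD//; try solve [exact: mphi|exact: mI|exact: phi0|
  by move=> z _; rewrite mule_ge0// lee_fin].
apply: ge0_le_integral => //.
- by move=> z _; rewrite adde_ge0 ?phi0// mule_ge0// lee_fin.
- by apply: emeasurable_funD => //; exact: mphi.
- by apply: emeasurable_funD; [exact: mphi|exact: mI].
- by move=> z _; rewrite -EFinM -!EFinD lee_fin; exact: choice_density_gap.
Qed.

Lemma uniform_pair_boxes (a b : V) (r s : R) :
  uniform_simplex (simplex_box a r) = s%:E ->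
  uniform_simplex (simplex_box b r) = s%:E ->
  pair_law (simplex_box a r `*` simplex_box b r) = (s ^+ 2)%:E.
Proof.
move=> ea eb.
transitivity (uniform_simplex (simplex_box a r) * uniform_simplex (simplex_box b r))%E.
  by apply: product_measure1E; exact: measurable_simplex_box.
by rewrite ea eb -EFinM expr2.
Qed.

End Excess.

(** * Failure of the estimator *)

Section Rate.
Context {R : realType}.
Variables (m : nat) (C k : R).
Local Notation D := (m.+1%:R : R).
Local Notation vol := (@simplex_volume R m).

(** eta^(2m) is the order of the joint mass of two opposed boxes, and eta^k that of the choice bias
    on them. *)
Definition rate (eta : R) : R := eta ^+ (2 * m) * eta `^ k.

(** Times [rate eta], this is C s^k times the squared box mass, for the margin s = eta / (4D) and
    radius r = eta / (16 D^3) of [opposed_boxes]: half of the gain in [choice_pair_gap], the other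
    half being reserved for the slab. *)
Definition raw_excess_const : R :=
  C * (4 * D)^-1 `^ k * ((2 / (16 * D ^+ 3)) ^+ m / vol) ^+ 2.

(* Capped at 1 so that it stays a legitimate probability gap even when no
   preference lies at distance [eta]. *)
Definition excess_const : R := Num.min 1 raw_excess_const.

(** The first bound keeps the handicap below the margin eta / (4D) on the boxes; the second keeps
    the mass of the slab below half of the gain. *)
Definition margin_const : R :=
  Num.min (8 * D)^-1 (excess_const * vol / (2 * D)).

Hypotheses (C_gt0 : 0 < C) (k_gt0 : 0 < k).

Let D_gt0 : 0 < D. Proof. by rewrite ltr0n. Qed.

Lemma rate_gt0 eta : 0 < eta -> 0 < rate eta.
Proof. by move=> eta0; rewrite mulr_gt0 ?exprn_gt0 ?powR_gt0. Qed.

Lemma rate_le eta : (0 < m)%N -> 0 < eta <= 1 -> rate eta <= eta.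
Proof.
move=> m0 /andP[eta0 eta1]; rewrite -[leRHS]mulr1; apply: ler_pM.
- exact: exprn_ge0 (ltW eta0).
- exact: powR_ge0.
- rewrite -[leRHS]expr1; apply: ler_wiXn2l => //; first exact: ltW.
  by rewrite muln_gt0.
- rewrite (_ : 1 = 1 `^ k); last by rewrite powR1.
  apply: ge0_ler_powR; rewrite ?nnegrE//; exact: ltW.
Qed.

Lemma excess_const_gt0 : 0 < excess_const.
Proof.
have V0 := @simplex_volume_gt0 R m.
rewrite lt_min ltr01/= /raw_excess_const mulr_gt0// ?mulr_gt0// ?powR_gt0 ?invr_gt0 ?mulr_gt0//.
Qed.

Lemma margin_const_gt0 : 0 < margin_const.
Proof.
have V0 := @simplex_volume_gt0 R m.
rewrite lt_min invr_gt0 mulr_gt0//=; apply: divr_gt0; last exact: mulr_gt0.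
by apply: mulr_gt0; first exact: excess_const_gt0.
Qed.

Lemma excess_rate_le1 eta : (0 < m)%N -> 0 < eta <= 1 ->
  0 < excess_const * rate eta <= 1.
Proof.
move=> m0 eta01; have /andP[eta0 eta1] := eta01; have th0 := rate_gt0 eta0.
rewrite (mulr_gt0 excess_const_gt0 th0)/= -[leRHS]mulr1; apply: ler_pM.
- by rewrite ltW// excess_const_gt0.
- exact: ltW.
- by rewrite /excess_const ge_min lexx.
- exact: le_trans (rate_le m0 eta01) eta1.
Qed.

End Rate.

Section Failure.
Context {R : realType} {m : nat} {d : measure_display} {T : measurableType d}.
Local Notation X := (simplex R m).
Local Notation V := 'rV[R]_m.+1.
Variables (x y : nat -> {mfun T >-> X}) (c : nat -> {mfun T >-> bool}).
Variables (q : X -> X -> R) (P : probability T R) (C k : R).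
Variables (w : preference R m) (est : nat -> T -> preference R m).
Hypothesis m_gt0 : (0 < m)%N.
Hypothesis nw : nonconstant_eu R m w.
Hypothesis hexp : experiment x y c q P.
Hypothesis q01 : forall p p', 0 <= q p p' <= 1.
Hypothesis mq : measurable_fun [set: X * X] (fun z => q z.1 z.2).
Hypothesis q_compl : forall p p', p <> p' -> q p' p = 1 - q p p'.
Hypothesis C_gt0 : 0 < C.
Hypothesis k_gt0 : 0 < k.
Local Notation u := (utility_index w).
Hypothesis q_ge : forall p p', strictly w p p' ->
  2^-1 + C * `|dot u p - dot u p'| `^ k <= q p p'.
Hypothesis hest : forall n t, kemeny_argmin x y c n t (est n t).

Let nu : normalized u := (utility_indexP nw).1.
Let uw : represents u w := (utility_indexP nw).2.

Let D_gt0 : 0 < m.+1%:R :> R. Proof. by rewrite ltr0n. Qed.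

Let q_ge_dot p p' : dot u p' < dot u p ->
  2^-1 + C * `|dot u p - dot u p'| `^ k <= q p p'.
Proof.
move=> pp'; apply: q_ge; split; first by apply/uw; exact: ltW.
by move=> /uw; rewrite leNgt pp'.
Qed.

(** [choice_pair_gap] is applied with [D] the product of the opposed boxes. The gain is at least
    twice [excess_const * rate], and the slab takes back at most one of the two. *)
Lemma excess_rate (v : V) (eta : R) j : normalized v -> 0 < eta <= 1 ->
  eta <= euclid_norm (v - u) ->
  (P (choice_pair x y c j @^-1` worse u 0) +
     (excess_const m C k * rate m k eta)%:E <=
   P (choice_pair x y c j @^-1` worse v (margin_const m C k * rate m k eta)))%E.
Proof.
move=> nv eta01 uv; have /andP[eta0 eta1] := eta01.
have V0 := @simplex_volume_gt0 R m.
have th0 := rate_gt0 m k eta0.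
set e := margin_const m C k * rate m k eta.
have e0 : 0 < e by rewrite mulr_gt0 ?margin_const_gt0.
have [a [b [ea eb hab]]] := opposed_boxes nu nv eta01 uv.
set r := eta / _ in ea eb hab.
set s := eta / (4 * m.+1%:R) in hab.
have s0 : 0 < s by rewrite divr_gt0// mulr_gt0.
have es : e < s.
  apply: (@le_lt_trans _ _ ((8 * m.+1%:R)^-1 * eta)).
    apply: ler_pM; rewrite ?(ltW th0) ?rate_le//.
      by rewrite ltW// margin_const_gt0.
    by rewrite /margin_const ge_min lexx.
  rewrite /s mulrC ltr_pM2l// ltf_pV2 ?posrE ?mulr_gt0//.
  by rewrite ltr_pM2r// ltr_nat.
pose B := simplex_box a r `*` simplex_box b r.
have mB : measurable B by apply: measurableX; exact: measurable_simplex_box.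
have hB z : B z -> s <= dot u z.1 - dot u z.2 /\ dot v z.1 - dot v z.2 < - e.
  by move=> [za zb]; have [? ?] := hab _ _ za zb; split => //; lra.
have := choice_pair_gap hexp q01 mq q_compl C_gt0 k_gt0 q_ge_dot j s0 (ltW e0) mB hB.
rewrite (uniform_pair_boxes ea eb) => gap.
have {gap} := le_trans gap (leeD (lexx _) (uniform_pair_slab nv (ltW e0))).
have mw v' e' : measurable (choice_pair x y c j @^-1` worse v' e').
  rewrite -[X in measurable X]setTI; apply: measurable_choice_pair => //.
  exact: measurable_worse.
have fP v' e' : P (choice_pair x y c j @^-1` worse v' e') \is a fin_num.
  by apply: fin_num_measure; exact: mw.
rewrite -(fineK (fP u 0)) -(fineK (fP v e)) -EFinM -!EFinD !lee_fin.
have : 2 * (excess_const m C k * rate m k eta) <=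
    2 * C * s `^ k * ((2 * r) ^+ m / @simplex_volume R m) ^+ 2.
  apply: (@le_trans _ _ (2 * (raw_excess_const m C k * rate m k eta))).
    by rewrite ler_pM2l// ler_pM2r// /excess_const ge_min lexx orbT.
  rewrite /s powRM; [|exact: ltW|by rewrite invr_ge0 mulr_ge0].
  rewrite /raw_excess_const /rate.
  rewrite (_ : 2 * r = 2 / (16 * m.+1%:R ^+ 3) * eta); last by rewrite /r; ring.
  rewrite [(_ * eta) ^+ m]exprMn mulnC exprM le_eqVlt.
  by apply/orP; left; apply/eqP; ring.
have : 2 * e * m.+1%:R / @simplex_volume R m <= excess_const m C k * rate m k eta.
  rewrite ler_pdivrMr//.
  have : e <= excess_const m C k * @simplex_volume R m / (2 * m.+1%:R) * rate m k eta.
    by rewrite ler_pM2r// /margin_const ge_min lexx orbT.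
  rewrite mulrAC ler_pdivlMr ?mulr_gt0//.
  by congr (_ <= _); ring.
lra.
Qed.

(** Grid cell of mesh 1 / M. Entries of a normalized vector lie in [-1, 1], so the truncations are
    at most 2 M and [inord] leaves them unchanged. *)
Let cell (M : nat) (v : V) : {ffun 'I_m.+1 -> 'I_(2 * M).+1} :=
  [ffun i => inord (Num.truncn ((v 0 i + 1) * M%:R))].

Let cell_close M (v v' : V) i : (0 < M)%N -> normalized v -> normalized v' ->
  cell M v = cell M v' -> `|v 0 i - v' 0 i| <= M%:R^-1.
Proof.
move=> M0 nv nv' /ffunP/(_ i); rewrite !ffunE => /(congr1 val)/=.
have M0' : 0 < M%:R :> R by rewrite ltr0n.
have tr (v0 : V) : normalized v0 -> let z := (v0 0 i + 1) * M%:R in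
    0 <= z /\ (Num.truncn z < (2 * M).+1)%N.
  move=> nv0 z; have := normalized_le1 i nv0; rewrite ler_norml => /andP[? ?].
  have z0 : 0 <= z by rewrite mulr_ge0//; lra.
  split => //; rewrite ltnS -(ler_nat R).
  have /andP[h _] := truncn_itv z0; apply: le_trans h _.
  by rewrite natrM ler_wpM2r//; lra.
have [z0 zM] := tr _ nv; have [z0' zM'] := tr _ nv'.
rewrite !inordK// => e.
have /andP[l1 l2] := truncn_itv z0; have /andP[l1' l2'] := truncn_itv z0'.
rewrite e in l1 l2; rewrite -natr1 in l2 l2'.
rewrite -(ler_pM2r M0') mulVf ?gt_eqF// -[X in _ * X](gtr0_norm M0') -normrM.
by rewrite ler_norml; lra.
Qed.

Lemma failure_bound (n M : nat) (eta : R) : (0 < n)%N -> 0 < eta <= 1 ->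
  2 / (margin_const m C k * rate m k eta) <= M%:R ->
  ((1 - ((2 * M).+1 ^ m.+1)%:R *
     (1 - (excess_const m C k * rate m k eta) ^+ 2 / 8) ^+ n)%:E <=
   inner_prob P (success est n w eta))%E.
Proof.
move=> n0 eta01; have /andP[eta0 eta1] := eta01.
set e := margin_const m C k * _ => eM.
set mu := excess_const m C k * _.
have e0 : 0 < e by rewrite mulr_gt0 ?margin_const_gt0 ?rate_gt0.
have M0 : (0 < M)%N by rewrite -(ltr_nat R); apply: lt_le_trans eM; rewrite divr_gt0.
have M0' : 0 < M%:R :> R by rewrite ltr0n.
have /andP[mu0 mu1] : 0 < mu <= 1 by exact: excess_rate_le1.
have mw v e' : measurable (worse v e' : set (X * X)) by exact: measurable_worse.
have mpw j v e' : measurable (choice_pair x y c j @^-1` worse v e').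
  by rewrite -[X in measurable X]setTI; exact: measurable_choice_pair.
have [N [mN PN hN]] := choice_pairs_distinct hexp q01 mq nu n.
pose far (K : {ffun 'I_m.+1 -> 'I_(2 * M).+1}) : set V :=
  [set v | [/\ normalized v, eta <= euclid_norm (v - u) & cell M v = K]].
(* The representative is fixed before sampling, so the Chernoff bound applies to it although the
   estimator depends on the sample. Cells without far vectors get the empty event. *)
pose rep K := xget 0 (far K).
pose bad v := [set t | (\sum_(j < n) (choice_pair x y c j t \in worse v e) <=
  \sum_(j < n) (choice_pair x y c j t \in worse u 0))%N].
have badP v : normalized v -> eta <= euclid_norm (v - u) ->
    measurable (bad v) /\ (P (bad v) <= ((1 - mu ^+ 2 / 8) ^+ n)%:E)%E.
  move=> nv uv; apply: (chernoff_count (obs := choice_pair x y c)) => //.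
  - exact: measurable_choice_pair.
  - exact: choice_pair_indep hexp.
  - by rewrite (ltW mu0).
  - by move=> j; exact: excess_rate.
pose F K := if `[< far K !=set0 >] then bad (rep K) else set0.
have FP K : measurable (F K) /\ (P (F K) <= ((1 - mu ^+ 2 / 8) ^+ n)%:E)%E.
  rewrite /F; case: asboolP => [[v Kv]|_].
    by have [? ? _] : far K (rep K) := xgetPex 0 (ex_intro _ v Kv); exact: badP.
  split => //; rewrite measure0 lee_fin exprn_ge0// subr_ge0.
  rewrite ler_pdivrMr// mul1r; apply: (@le_trans _ _ 1); last by rewrite ler1n.
  by rewrite expr_le1// ltW.
pose U := N `|` \big[setU/set0]_K F K.
have mF : measurable (\big[setU/set0]_K F K).
  by apply: bigsetU_measurable => K _; have [] := FP K.
have mU : measurable U by exact: measurableU.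
have PU : (P U <= (((2 * M).+1 ^ m.+1)%:R * (1 - mu ^+ 2 / 8) ^+ n)%:E)%E.
  apply: (@le_trans _ _ (P N + P (\big[setU/set0]_K F K))%E).
    exact: measureU2.
  rewrite PN add0e.
  apply: le_trans (measure_bigsetU_le _ _ _ (fun K => (FP K).1)) _.
  apply: (@le_trans _ _ (\sum_(K : {ffun 'I_m.+1 -> 'I_(2 * M).+1})
      ((1 - mu ^+ 2 / 8) ^+ n)%:E)%E).
    by apply: lee_sum => K _; have [] := FP K.
  rewrite sumEFin lee_fin sumr_const card_ffun !card_ord.
  by rewrite -[_ *+ _]mulr_natl.
(* The complement of [U] is a measurable subset of the success event, as the inner probability
   requires. *)
apply: (@le_trans _ _ (P (~` U))).
  rewrite probability_setC// -(fineK (fin_num_measure P _ mU)) -EFinB lee_fin.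
  by rewrite lerD2l lerN2 -lee_fin fineK// fin_num_measure.
apply: ereal_sup_ubound; exists (~` U) => //; split; first exact: measurableC.
move=> t Ut; rewrite /success/= ltNge; apply/negP => dist.
have [nest est_min] := hest n t.
have [nv vw] := utility_indexP nest.
set v := utility_index (est n t) in nv vw.
have farv : far (cell M v) v by [].
have [nr ur cr] : far (cell M v) (rep (cell M v)) := xgetPex 0 (ex_intro _ v farv).
have inj := hN t (fun Nt => Ut (or_introl Nt)).
apply: Ut; right; rewrite -bigcup_seq; exists (cell M v) => //=.
  by rewrite mem_index_enum.
rewrite /F asboolT; last by exists v.
have := est_min w nw; rewrite /kemeny_loss !(card_revealed_setD _ inj).
rewrite ler_pM2l ?invr_gt0 ?ltr0n// ler_nat /bad/= => est_le.
(* Chain of counts: handicapped errors of the representative, at most the loss of the estimator, at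
   most the loss of [w], at most the errors of [u]. The first link holds because the two vectors
   share a cell and 2 / M <= e. The outcome is the bad event. *)
apply: (@leq_trans (\sum_(j < n) (choice_pair x y c j t \in ~` est n t))).
  apply: leq_sum => j _; case: (choice_pair x y c j t) => p p'.
  case: (boolP (_ \in worse _ _)) => // /set_mem; rewrite /worse/= => pp'.
  rewrite mem_set//= => /vw vpp'.
  have := dot_sub_perturb (u := rep (cell M v)) (v := v) p p'
    (fun i => cell_close i M0 nr nv cr).
  rewrite ler_norml => /andP[h _].
  have : 2 * M%:R^-1 <= e.
    by rewrite ler_pdivrMr// mulrC -ler_pdivrMr.
  by move: vpp'; lra.
apply: (leq_trans est_le); apply: leq_sum => j _.
case: (choice_pair x y c j t) => p p'.
case: (boolP (_ \in ~` w)) => // /set_mem/= wpp'.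
rewrite mem_set// /worse/= oppr0 subr_lt0 ltNge; apply/negP => pp'.
by apply: wpp'; apply/uw.
Qed.

End Failure.

(** * Sample complexity *)

Section SuccessRate.
Context {R : realType} {m : nat} {d : measure_display} {T : measurableType d}.
Local Notation X := (simplex R m).
Variables (q : preference R m -> X -> X -> R) (C k : R).
Variables (P : preference R m -> probability T R).
Variables (x y : nat -> {mfun T >-> X}) (c : nat -> {mfun T >-> bool}).
Variable est : nat -> T -> preference R m.
Hypothesis m_gt0 : (0 < m)%N.
Hypothesis q_error : error_probability q.
Hypotheses (C_gt0 : 0 < C) (k_gt0 : 0 < k).
Hypothesis q_ge : forall w, nonconstant_eu R m w ->
  forall p p', strictly w p p' ->
    2^-1 + C * `|dot (utility_index w) p - dot (utility_index w) p'| `^ k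
    <= q w p p'.
Hypothesis hexp : forall w, nonconstant_eu R m w -> experiment x y c (q w) (P w).
Hypothesis hest : forall n t, kemeny_argmin x y c n t (est n t).

(** [B / rate] bounds the number 2 M + 1 of grid values per coordinate when M is about 2 /
    (margin_const * rate); the 3 absorbs rounding, since the rate is at most 1. *)
Let B : R := 4 / margin_const m C k + 3.
Let a : R := excess_const m C k ^+ 2 / 8.

Let B_gt0 : 0 < B.
Proof. by have := margin_const_gt0 m k C_gt0 => h; rewrite addr_gt0// divr_gt0. Qed.

Let a_gt0 : 0 < a.
Proof. by have := excess_const_gt0 m k C_gt0 => h; rewrite divr_gt0// exprn_gt0. Qed.

Lemma success_bound (n : nat) (w : preference R m) (eta : R) :
  nonconstant_eu R m w -> (0 < n)%N -> 0 < eta <= 1 ->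
  ((1 - (B / rate m k eta) ^+ m.+1 *
        expR (- (a * rate m k eta ^+ 2 * n%:R)))%:E <=
   inner_prob (P w) (success est n w eta))%E.
Proof.
move=> nw n0 eta01; have /andP[eta0 eta1] := eta01.
have th0 := rate_gt0 m k eta0.
have th1 : rate m k eta <= 1 by exact: le_trans (rate_le k_gt0 m_gt0 eta01) eta1.
have m0 := margin_const_gt0 m k C_gt0.
pose z := 2 / (margin_const m C k * rate m k eta).
have z0 : 0 <= z by rewrite divr_ge0// mulr_ge0// ltW.
have /andP[zM Mz] := truncn_itv z0.
have := @failure_bound _ _ _ _ x y c _ _ C k w est m_gt0 nw (hexp nw)
  (error_prob_01 q_error nw) (error_prob_measurable q_error nw)
  (error_prob_compl q_error nw) C_gt0 k_gt0 (q_ge nw) hest n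
  (Num.truncn z).+1 eta n0 eta01 (ltW Mz).
apply: le_trans; rewrite lee_fin lerD2l lerN2.
set mu := excess_const m C k * _.
have /andP[mu0 mu1] : 0 < mu <= 1 by exact: excess_rate_le1.
have mu2 : 0 <= 1 - mu ^+ 2 / 8.
  have : mu ^+ 2 <= 1 by rewrite expr_le1// ltW.
  lra.
have -> : - (a * rate m k eta ^+ 2 * n%:R) = n%:R * - (mu ^+ 2 / 8).
  by rewrite /a /mu; ring.
rewrite expRM_natl natrX; apply: ler_pM; rewrite ?exprn_ge0//.
- apply: lerXn2r; rewrite ?nnegrE// ?divr_ge0 ?(ltW B_gt0) ?(ltW th0)//.
  rewrite -natr1 natrM -natr1.
  apply: (@le_trans _ _ (2 * z + 3)); first by lra.
  rewrite /B [leRHS]mulrDl; apply: lerD.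
    by rewrite /z le_eqVlt; apply/orP; left; apply/eqP; field; rewrite !gt_eqF.
  by rewrite ler_pdivlMr// ler_piMr.
- by apply: lerXn2r; rewrite ?nnegrE ?expR_ge0//; exact: expR_ge1Dx.
Qed.

(** Since delta <= 1/e, l = ln (1 / delta) is at least 1. The crude bound B / th <= exp (B / th)
    suffices for the number of cells: for n of order th^-4 l, the exponent a th^2 n is at least ((m
    + 1) B + 1) th^-2 l, which dominates (m + 1) B / th + l. *)
Let theta_sample (eta delta : R) : 0 < eta <= 1 -> 0 < delta <= expR (-1) ->
  (sample_complexity P est eta delta <=
   ((((m.+1%:R * B + 1) / a + 1) * ((rate m k eta ^+ 4)^-1 * ln (1 / delta)))%:E))%E.
Proof.
move=> eta01 /andP[delta0 delta1]; have /andP[eta0 eta1] := eta01.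
set th := rate m k eta; have th0 : 0 < th by exact: rate_gt0.
have th1 : th <= 1 by exact: le_trans (rate_le k_gt0 m_gt0 eta01) eta1.
set l := ln _; have l1 : 1 <= l.
  by rewrite /l div1r lnV ?posrE// lerNr -ler_expR lnK ?posrE.
set K1 := (_ + 1) / a; have K10 : 0 < K1.
  by rewrite divr_gt0// addr_gt0// mulr_gt0.
have th4 : 1 <= (th ^+ 4)^-1.
  by rewrite invf_ge1 ?exprn_gt0// exprn_ile1// ltW.
pose z := K1 * ((th ^+ 4)^-1 * l).
have z0 : 0 <= z by rewrite mulr_ge0 ?(ltW K10)// mulr_ge0//; lra.
have /andP[zN Nz] := truncn_itv z0.
(* Rounding [z] up costs at most 1 <= th^-4 l, hence the [+ 1] in the constant. *)
apply: (@le_trans _ _ ((Num.truncn z).+1%:R)%:E); last first.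
  rewrite lee_fin -natr1 mulrDl mul1r lerD// -[leLHS]mulr1.
  by apply: ler_pM.
apply: ereal_inf_lbound; exists (Num.truncn z).+1 => // n Nn w nw.
have n0 : (0 < n)%N by apply: leq_trans Nn.
apply: le_trans (success_bound nw n0 eta01); rewrite lee_fin lerD2l lerN2 -/th.
have zn : z <= n%:R.
  by apply: (le_trans (ltW Nz)); rewrite ler_nat.
apply: (@le_trans _ _ (expR (m.+1%:R * (B / th)) * expR (- (a * th ^+ 2 * n%:R)))).
  rewrite ler_pM2r ?expR_gt0// expRM_natl; apply: lerXn2r.
  - by rewrite nnegrE divr_ge0// ltW.
  - by rewrite nnegrE expR_ge0.
  - by apply: le_trans (expR_ge1Dx _); rewrite lerDr.
rewrite -expRD -[leRHS]lnK ?posrE// ler_expR.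
have -> : ln delta = - l by rewrite /l div1r lnV ?posrE// opprK.
have : a * th ^+ 2 * z <= a * th ^+ 2 * n%:R.
  by rewrite ler_pM2l// mulr_gt0// exprn_gt0.
have -> : a * th ^+ 2 * z = m.+1%:R * B * ((th ^+ 2)^-1 * l) + (th ^+ 2)^-1 * l.
  by rewrite /z /K1; field; rewrite !gt_eqF.
have t1 : 1 <= th^-1 by rewrite invf_ge1.
have t2 : th^-1 <= (th ^+ 2)^-1 by rewrite lef_pV2 ?posrE ?exprn_gt0// expr2 ler_piMl// ltW.
have : l <= (th ^+ 2)^-1 * l by rewrite ler_peMl//; lra.
have : m.+1%:R * (B / th) <= m.+1%:R * B * ((th ^+ 2)^-1 * l).
  rewrite mulrA ler_pM2l ?mulr_gt0//; apply: (le_trans t2).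
  by rewrite ler_peMr//; lra.
lra.
Qed.

Lemma rate_pow4 (eta : R) : 0 < eta ->
  eta `^ (8 * m%:R + 4 * k) = rate m k eta ^+ 4.
Proof.
move=> eta0; rewrite powRD; last by rewrite (gt_eqF eta0) implybT.
rewrite -natrM powR_mulrn ?(ltW eta0)// [4 * k]mulrC powRrM.
rewrite (powR_mulrn 4) ?powR_ge0// /rate exprMn -exprM.
by congr (_ ^+ _ * _); rewrite mulnAC.
Qed.

(** For fixed accuracy the failure bound is geometric in n. Replacing eta by its minimum with 1 only
    shrinks the success event and meets the range of [success_bound]. *)
Lemma consistent_estimator : consistent P est.
Proof.
move=> w nw eta eta0.
pose e := Num.min eta 1.
have e01 : 0 < e <= 1 by rewrite lt_min eta0 ltr01 ge_min lexx orbT.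
have /andP[e0 _] := e01.
have th0 := rate_gt0 m k e0.
pose L := (B / rate m k e) ^+ m.+1; pose r := expR (- (a * rate m k e ^+ 2)).
have r1 : `|r| < 1.
  rewrite ger0_norm ?expR_ge0// -expR0 ltr_expR oppr_lt0.
  by rewrite mulr_gt0// exprn_gt0.
apply: (@squeeze_cvge _ _ _ _ (fun n => (1 - L * r ^+ n)%:E) _ (fun=> 1%E)).
- near=> n; apply/andP; split; last first.
    apply: ge_ereal_sup => _ [A [mA _] <-]; exact: probability_le1.
  apply: (@le_trans _ _ (inner_prob (P w) (success est n w e))).
    have n0 : (0 < n)%N by near: n; exact: nbhs_infty_gt.
    have := success_bound nw n0 e01; congr (_ <= _)%E; congr (1 - L * _)%:E.
    by rewrite /r -expRM_natl; congr expR; ring.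
  apply: ge_ereal_sup => _ [A [mA Ae] <-].
  apply: ereal_sup_ubound; exists A => //; split => // t /Ae.
  by rewrite /success/= => h; apply: (lt_le_trans h); rewrite ge_min lexx.
- apply: cvg_EFin; first by near=> n.
  rewrite -[X in _ --> X]subr0; apply: cvgB; first exact: cvg_cst.
  exact: cvg_geometric.
- exact: cvg_cst.
Unshelve. all: by end_near. Qed.

Lemma sample_complexity_le : exists K : R,
  \forall eta \near 0^'+ & delta \near 0^'+,
    (sample_complexity P est eta delta <=
     (K * (1 / eta `^ (8 * m%:R + 4 * k) * ln (1 / delta)))%:E)%E.
Proof.
exists ((m.+1%:R * B + 1) / a + 1).
exists ([set eta | 0 < eta <= 1], [set delta | 0 < delta <= expR (-1)]).
  split; near=> e; apply/andP; split.
  - by near: e; exact: nbhs_right_gt.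
  - by near: e; apply: nbhs_right_le.
  - by near: e; exact: nbhs_right_gt.
  - by near: e; apply: nbhs_right_le; exact: expR_gt0.
move=> [eta delta] /= [eta01 delta01].
have /andP[eta0 _] := eta01.
by rewrite rate_pow4// (div1r (rate m k eta ^+ 4)); exact: theta_sample.
Unshelve. all: by end_near. Qed.

End SuccessRate.

Unset Implicit Arguments.

Theorem corollary4 (R : realType) (d : nat) (d_ge2 : (2 <= d)%N)
    (q : preference R d.-1 -> simplex R d.-1 -> simplex R d.-1 -> R)
    (q_error : error_probability q)
    (C k : R) (C_gt0 : 0 < C) (k_gt0 : 0 < k)
    (q_ge : forall w, nonconstant_eu R d.-1 w ->
       forall p p', strictly w p p' ->
         2^-1 + C * `|dot (utility_index w) p - dot (utility_index w) p'| `^ k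
         <= q w p p')
    (dT : measure_display) (T : measurableType dT)
    (P : preference R d.-1 -> probability T R)
    (x y : nat -> {mfun T >-> simplex R d.-1})
    (c : nat -> {mfun T >-> bool})
    (hexp : forall w, nonconstant_eu R d.-1 w -> experiment x y c (q w) (P w))
    (est : nat -> T -> preference R d.-1)
    (hest : forall n t, kemeny_argmin x y c n t (est n t)) :
  consistent P est /\
  exists K : R, \forall eta \near 0^'+ & delta \near 0^'+,
    (sample_complexity P est eta delta <=
     (K * (1 / eta `^ (8 * (d.-1)%:R + 4 * k) * ln (1 / delta)))%:E)%E.
Proof.
have m_gt0 : (0 < d.-1)%N by rewrite -subn1 subn_gt0.
split.
- exact: (consistent_estimator m_gt0 q_error C_gt0 k_gt0 q_ge hexp hest).
- exact: (sample_complexity_le m_gt0 q_error C_gt0 k_gt0 q_ge hexp hest).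
Qed.
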